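(* Let $C_1,\ldots,C_m\subseteq\mathcal{E}$ be closed convex sets with $C:=\bigcap_{i=1}^mC_i\neq\emptyset$, and let $\Phi$ be a strict consistent error bound function for $C_1,\ldots,C_m$. Suppose that $C$ is not the whole space and that $\kappa\ge\max\{\mathrm{dist}(0,C),\|x^0\|\}$ for some $x^0\notin C$. Suppose also that $\Phi(\cdot,\kappa)$ is continuous and belongs to $\mathrm{RV}^0$ with index $\rho$. Let $\Psi$ be given by $\Psi(t):=-\Phi^\spadesuit_\kappa(1/t)$. Then the following hold. (i) $\rho\in[0,1]$. (ii) If $\rho\in(0,1)$, then $\Psi$ belongs to $\mathrm{RV}$ with index $(1/\rho)-1$. In particular, $\Psi^{-1}\in\mathrm{RV}$ has index $\frac{\rho}{1-\rho}$, and for every $\delta>0$ such that $\gamma:=\rho/(1-\rho)-\delta$ is positive, there are constants $M$ and $A$ such that $$\sqrt{(\Phi^\spadesuit_\kappa)^{-1}(-s)}\le A\Big(\frac1s\Big)^{\gamma/2}\qquad\forall\,s\ge M.$$ (iii) If $\rho=1$, then $\Psi$ belongs to $\mathrm{RV}$ with index $0$. In particular, $\Psi^{-1}$ belongs to $\mathrm{RV}_\infty$ and for every $r>0$, $$\sqrt{(\Phi^\spadesuit_\kappa)^{-1}(-s)}=o(s^{-r})\quad\text{as }s\to+\infty.$$ (iv) If $\rho=0$, then $\Psi$ belongs to $\mathrm{RV}_\infty$. In particular, $\Psi^{-1}$ belongs to $\mathrm{RV}$ with index $0$, and for any $r>0$ we have $s^{-r}=o\big((\Phi^\spadesuit_\kappa)^{-1}(-s)\big)$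 as $s\to\infty$.
   Context: $\mathcal{E}$ is a finite-dimensional real vector space with norm $\|\cdot\|$ induced by an inner product, and $\mathrm{dist}(x,D)=\min_{y\in D}\|x-y\|$ for a nonempty closed convex set $D$. ''Monotone increasing'' means strictly increasing. A function $\Phi:[0,\infty)\times[0,\infty)\to[0,\infty)$ is a consistent error bound function for $C_1,\ldots,C_m$ if: (i) $\mathrm{dist}(x,C)\le\Phi\big(\max_{1\le i\le m}\mathrm{dist}(x,C_i),\|x\|\big)$ for all $x\in\mathcal{E}$; (ii) for every fixed $b\ge 0$, $\Phi(\cdot,b)$ is monotone nondecreasing on $[0,\infty)$, right-continuous at $0$, and $\Phi(0,b)=0$; (iii) for every fixed $a\ge0$, $\Phi(a,\cdot)$ is monotone nondecreasing on $[0,\infty)$. It is strict if in addition $\Phi(\cdot,b)$ is monotone increasing on $[0,\infty)$ for every $b>0$. For a monotone increasing $f:[0,\infty)\to[0,\infty)$, $f^-(s):=\inf\{t\ge0: f(t)\ge s\}$ for $0\le s<\sup f$. For $\kappa>0$, $\phi_{\kappa,\Phi}(t):=(\Phi(\sqrt t,\kappa))^2$, $t\ge0$, and $\Phi^\spadesuit_\kappa(t):=\int_{\delta_0}^t\frac{1}{\phi^-_{\kappa,\Phi}(s)}\,ds$ for $t\in(0,\sup\phi_{\kappa,\Phi})$, with $\delta_0\in(0,\sup\phi_{\kappa,\Phi})$ some fixed (arbitrary) number; it is strictly increasing and continuous, with inverse $(\Phi^\spadesuit_\kappa)^{-1}$ defined on its range. A measurable $f:[a,\infty)\to(0,\infty)$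 ($a>0$) belongs to $\mathrm{RV}$ with index $\rho\in\mathbb{R}$ if $\lim_{x\to\infty}f(\lambda x)/f(x)=\lambda^\rho$ for all $\lambda>0$; it belongs to $\mathrm{RV}_\infty$ if $\lim_{x\to\infty}f(\lambda x)/f(x)$ equals $0$, $1$, $+\infty$ for $\lambda\in(0,1)$, $\lambda=1$, $\lambda\in(1,\infty)$, respectively. A measurable $f:(0,a]\to(0,\infty)$ belongs to $\mathrm{RV}^0$ with index $\rho$ if $\lim_{x\to0_+}f(\lambda x)/f(x)=\lambda^\rho$ for all $\lambda>0$. Membership is understood after restriction to some $[a,\infty)$ (resp. $(0,a]$), $a>0$. ''$f(t)=o(g(t))$ as $t\to c$'' means $\lim_{t\to c}f(t)/g(t)=0$. *)

(* Defs.v *)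
From HB Require Import structures.
From mathcomp Require Import all_boot all_order all_algebra.
From mathcomp Require Import all_classical all_reals all_analysis.

Set Implicit Arguments.
Unset Strict Implicit.
Unset Printing Implicit Defensive.

Import Order.TTheory GRing.Theory Num.Theory.
Import numFieldNormedType.Exports.

Local Open Scope classical_set_scope.
Local Open Scope ring_scope.

Definition finite_dimensional (R : realType) (E : normedModType R) : Prop :=
  exists (n : nat) (e : 'I_n -> E),
    forall x : E, exists c : 'I_n -> R, x = \sum_(i < n) c i *: e i.

(* For D nonempty and closed in a finite-dimensional space the infimum is
   attained, so this is the minimum. *)
Definition set_dist (R : realType) (E : normedModType R) (x : E) (D : set E)
    : R :=
  inf [set `|x - y| | y in D].

(* Phi is a total function; only its values on [0, +oo) x [0, +oo) matter.
   Distances are nonnegative, so the neutral element 0 of the iterated maximum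
   does not affect its value. *)
Definition consistent_error_bound (R : realType) (E : normedModType R)
    (m : nat) (Cs : 'I_m -> set E) (Phi : R -> R -> R) : Prop :=
  [/\ forall a b, 0 <= a -> 0 <= b -> 0 <= Phi a b,
      forall x : E,
        set_dist x (\bigcap_i Cs i)
          <= Phi (\big[Num.max/0]_(i < m) set_dist x (Cs i)) `|x|,
      forall b, 0 <= b ->
        [/\ {in `[0, +oo[ &, {homo Phi^~ b : s t / s <= t}},
            Phi a b @[a --> 0^'+] --> Phi 0 b
          & Phi 0 b = 0]
    & forall a, 0 <= a -> {in `[0, +oo[ &, {homo Phi a : s t / s <= t}}].

Definition strict_consistent_error_bound (R : realType) (E : normedModType R)
    (m : nat) (Cs : 'I_m -> set E) (Phi : R -> R -> R) : Prop :=
  consistent_error_bound Cs Phi /\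
  forall b, 0 < b -> {in `[0, +oo[ &, {homo Phi^~ b : s t / s < t}}.

Definition gen_inv (R : realType) (f : R -> R) (s : R) : R :=
  inf [set t | 0 <= t /\ s <= f t].

Definition phi_of (R : realType) (kappa : R) (Phi : R -> R -> R) (t : R) : R :=
  Phi (Num.sqrt t) kappa ^+ 2.

(* The open interval (0, sup phi), where the supremum may be +oo. *)
Definition spade_dom (R : realType) (kappa : R) (Phi : R -> R -> R) : set R :=
  [set t : R | 0 < t /\
     (t%:E < ereal_sup [set (phi_of kappa Phi u)%:E | u in `[0%R, +oo[])%E].

Definition oriented_integral (R : realType) (f : R -> R) (a b : R) : R :=
  if a <= b then \int[lebesgue_measure]_(s in `[a, b]) f s
  else - \int[lebesgue_measure]_(s in `[b, a]) f s.

Definition spade (R : realType) (kappa : R) (Phi : R -> R -> R) (d0 t : R)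
    : R :=
  oriented_integral (fun s => (gen_inv (phi_of kappa Phi) s)^-1) d0 t.

Definition spade_inv (R : realType) (kappa : R) (Phi : R -> R -> R) (d0 : R)
    : R -> R :=
  'pinv_(fun=> 0) (spade_dom kappa Phi) (spade kappa Phi d0).

Definition spade_range (R : realType) (kappa : R) (Phi : R -> R -> R) (d0 : R)
    : set R :=
  spade kappa Phi d0 @` spade_dom kappa Phi.

Definition Psi_dom (R : realType) (kappa : R) (Phi : R -> R -> R) : set R :=
  [set t | spade_dom kappa Phi t^-1].

Definition Psi_of (R : realType) (kappa : R) (Phi : R -> R -> R) (d0 t : R)
    : R :=
  - spade kappa Phi d0 t^-1.

Definition Psi_range (R : realType) (kappa : R) (Phi : R -> R -> R) (d0 : R)
    : set R :=
  Psi_of kappa Phi d0 @` Psi_dom kappa Phi.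

Definition Psi_inv (R : realType) (kappa : R) (Phi : R -> R -> R) (d0 : R)
    : R -> R :=
  'pinv_(fun=> 0) (Psi_dom kappa Phi) (Psi_of kappa Phi d0).

(* In [in_RV] and [in_RV_infty], D is the domain of the partial function that f
   represents: it has to contain the half-line to which f is restricted. *)
Definition in_RV (R : realType) (D : set R) (f : R -> R) (rho : R) : Prop :=
  exists a : R,
    [/\ 0 < a,
        `[a, +oo[ `<=` D,
        measurable_fun `[a, +oo[ f,
        {in `[a, +oo[, forall x, 0 < f x}
      & forall l : R, 0 < l -> f (l * x) / f x @[x --> +oo] --> l `^ rho].

Definition in_RV_infty (R : realType) (D : set R) (f : R -> R) : Prop :=
  exists a : R,
    [/\ 0 < a,
        `[a, +oo[ `<=` D,
        measurable_fun `[a, +oo[ f,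
        {in `[a, +oo[, forall x, 0 < f x}
      & [/\ forall l : R, 0 < l < 1 -> f (l * x) / f x @[x --> +oo] --> (0 : R),
            f (1 * x) / f x @[x --> +oo] --> (1 : R)
          & forall l : R, 1 < l -> f (l * x) / f x @[x --> +oo] --> +oo]].

Definition in_RV0 (R : realType) (f : R -> R) (rho : R) : Prop :=
  exists a : R,
    [/\ 0 < a,
        measurable_fun `]0, a] f,
        {in `]0, a], forall x, 0 < f x}
      & forall l : R, 0 < l -> f (l * x) / f x @[x --> 0^'+] --> l `^ rho].

(* f = o(g) at +oo, where both f and g have to be defined on D. *)
Definition little_o_pinfty (R : realType) (D : set R) (f g : R -> R) : Prop :=
  (\forall s \near +oo, D s) /\ f s / g s @[s --> +oo] --> (0 : R).

(* Main.v *)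
Require Import Defs.
From HB Require Import structures.
From mathcomp Require Import all_boot all_order all_algebra.
From mathcomp Require Import all_classical all_reals all_analysis.
From mathcomp Require Import ring lra.
Import Order.TTheory GRing.Theory Num.Theory.
Import numFieldNormedType.Exports.
Local Open Scope classical_set_scope.
Local Open Scope ring_scope.

Set Implicit Arguments.
Unset Strict Implicit.
Unset Printing Implicit Defensive.

(**
The quantities of the theorem are all read off from one function,
phi(t) = Phi(sqrt t, kappa)^2, by inversions and an integration, each of which
transforms an index of regular variation in a simple way.

- phi varies regularly at 0 with the index rho of Phi(., kappa).

- Its inverse g varies regularly at 0 with index 1/rho: if f is increasing with
  inverse g, the inequality g(l y) < c g(y) is equivalent to
  l f(x) < f(c x) at x = g(y), so limits of ratios of f turn into limits of
  ratios of g ([ratio_index_inverse]).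

- Psi is an antiderivative of t^-2 / g(1/t), and Psi tends to infinity; by the
  infinity over infinity form of L'Hopital's rule the limit of
  Psi(l t) / Psi(t) is that of the ratio of the derivatives, so Psi has index
  1/rho - 1 at infinity ([ratio_index_primitive]).

- The inversion argument, now at infinity, gives the index
  1/(1/rho - 1) = rho/(1 - rho) for the inverse of Psi.

The indices are allowed to be infinite ([epowR]), rapid variation being the
index +oo and 1/0 being +oo; the cases rho = 0, 0 < rho < 1 and rho = 1 are
then instances of the same four steps.

Geometry enters through the single inequality t <= Phi(t, kappa) for small t
([error_bound_ge_id]): a segment from x0 towards an almost shortest vector of C
stays in the ball of radius kappa until it is close to C, and meets points at
every small distance t from C, to which the error bound applies.  The
inequality makes g(s) <= s near 0, hence the integral of 1/g diverges at 0 and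
Psi tends to infinity, and it forces rho <= 1; monotonicity of phi forces
rho >= 0.

The estimates on (Phi^spade)^-1(-s), which is 1 / Psi^-1(s), follow from a
comparison with powers: if 2^r f(x) <= f(2x) eventually, iterating along powers
of 2 gives f(x) >= c x^r ([power_growth]), and this applies to Psi^-1 with any
r below its index and to 1 / Psi^-1 with any negative r when rho = 0.
*)

(** * Ratio limits with extended exponents *)

(** The limit of the ratio f(l x) / f(x) for a function of index [a]; the
index +oo is that of rapid variation, and -oo is the one of its reciprocal. *)
Definition epowR (R : realType) (l : R) (a : \bar R) : \bar R :=
  match a with
  | r%:E => (l `^ r)%:E
  | +oo%E => if l < 1 then 0%E else if l == 1 then 1%E else +oo%E
  | -oo%E => if l < 1 then +oo%E else if l == 1 then 1%E else 0%E
  end.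

Definition ratio_index (R : realType) (F : set_system R) (f : R -> R)
    (a : \bar R) : Prop :=
  forall l : R, 0 < l -> (f (l * x) / f x)%:E @[x --> F] --> epowR l a.

(** Convergence to an extended real as eventual strict inequalities, the only
form in which ratio limits are manipulated below. *)
Lemma cvg_EFin_ltP (R : realType) (T : Type) (F : set_system T) (FF : Filter F)
    (r : T -> R) (L : \bar R) :
  (r x)%:E @[x --> F] --> L <->
  (forall c : R, (L < c%:E)%E -> \forall x \near F, r x < c) /\
  (forall c : R, (c%:E < L)%E -> \forall x \near F, c < r x).
Proof.
case: L => [l| |]; split.
- move=> /fine_cvgP[_ /= rl]; split=> c; rewrite lte_fin => lc.
    exact: (cvgr_lt l rl).
  exact: (cvgr_gt l rl).
- move=> [up lo]; apply/fine_cvgP; split; first exact: nearW.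
  apply/cvgrPdist_lt => e e0 /=.
  have := up (l + e); have := lo (l - e).
  rewrite !lte_fin ltrDl ltrBlDr ltrDl e0 => /(_ isT) lo1 /(_ isT) up1.
  near=> x; rewrite ltr_distlC; apply/andP; split; near: x => //.
- move=> /cvgeryP/cvgryPgt rl; split=> c; last by move=> _; exact: rl.
  by rewrite ltNge leey.
- by move=> [_ lo]; apply/cvgeryP/cvgryPgt => A; apply: lo; rewrite ltry.
- move=> /cvgerNyP/cvgrNyPlt rl; split=> c; first by move=> _; exact: rl.
  by rewrite ltNge leNye.
- by move=> [up _]; apply/cvgerNyP/cvgrNyPlt => A; apply: up; rewrite ltNyr.
Unshelve. all: by end_near. Qed.

(** The map l |-> l^a is increasing with inverse l |-> l^(1/a), and
this persists at a = 0 and a = +oo, except that for a = 0 and l = 1 the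
conclusion would read 1 < 1. *)
Lemma epowR_lt_inv (R : realType) (l c : R) (a : \bar R) :
  0 < l -> l != 1 -> (0 <= a)%E -> (epowR l a^-1 < c%:E)%E ->
  0 < c /\ (l%:E < epowR c a)%E.
Proof.
move=> l0 l1; case: a => [r| |//] /=.
- rewrite lee_fin le_eqVlt => /predU1P[<-|r0].
    rewrite inve0 /=; case: (ltgtP l 1) l1 => // ll _.
    by rewrite lte_fin powRr0 lte_fin => ->.
  rewrite inver gt_eqF //= lte_fin => lc.
  have c0 : 0 < c by apply: le_lt_trans lc; exact: powR_ge0.
  split => //; rewrite lte_fin.
  have -> : l = (l `^ r^-1) `^ r by rewrite -powRrM mulVf ?gt_eqF// powRr1// ltW.
  by apply: gt0_ltr_powR => //; rewrite nnegrE ?powR_ge0// ltW.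
- move=> _; rewrite powRr0 lte_fin => c1; split; first exact: lt_trans c1.
  by case: ltgtP c1 => // _ _; exact: ltry.
Qed.

Lemma epowR_gt_inv (R : realType) (l c : R) (a : \bar R) :
  0 < l -> l != 1 -> (0 <= a)%E -> 0 < c -> (c%:E < epowR l a^-1)%E ->
  (epowR c a < l%:E)%E.
Proof.
move=> l0 l1; case: a => [r| |//] /=.
- rewrite lee_fin le_eqVlt => /predU1P[<-|r0] c0.
    rewrite inve0 /=; case: (ltgtP l 1) l1 => // ll _.
      by rewrite lte_fin ltNge ltW.
    by rewrite powRr0 lte_fin.
  rewrite inver gt_eqF //= !lte_fin => lc.
  have -> : l = (l `^ r^-1) `^ r by rewrite -powRrM mulVf ?gt_eqF// powRr1// ltW.
  by apply: gt0_ltr_powR => //; rewrite nnegrE ?powR_ge0// ltW.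
- by move=> _ c0; rewrite powRr0 lte_fin => c1; rewrite c1.
Qed.

Lemma epowRB1 (R : realType) (l : R) (a : \bar R) : 0 < l ->
  ((l^-1)%:E * epowR l a = epowR l (a - 1))%E.
Proof.
move=> l0; case: a => [r| |] /=.
- rewrite -EFinM; congr EFin.
  rewrite (powRD (s := -1)); last by rewrite (gt_eqF l0) implybT.
  by rewrite powR_inv1 ?ltW// mulrC.
- by case: (ltgtP l 1) => [||->]; rewrite ?mule0 ?invr1 ?mule1// => _;
    rewrite gt0_muley // lte_fin invr_gt0.
- by case: (ltgtP l 1) => [||->]; rewrite ?mule0 ?invr1 ?mule1// => _;
    rewrite gt0_muley // lte_fin invr_gt0.
Qed.

(** The inverse of an increasing function of index [a] has index 1/[a]. With
x = g(y), the inequality g(l y) < c g(y) reads l f(x) < f(c x), and it holds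
eventually as soon as l < c^a. The two filters are arbitrary so that the lemma
serves both at 0 and at infinity. *)
Lemma ratio_index_inverse (R : realType) (F G : set_system R)
    (FF : Filter F) (FG : Filter G) (D : set R) (f g : R -> R) (a : \bar R) :
  (forall x y, D x -> D y -> x < y -> f x < f y) ->
  (forall y, (f @` D) y -> D (g y) /\ f (g y) = y) ->
  g y @[y --> G] --> F ->
  (forall l, 0 < l -> \forall y \near G, (f @` D) (l * y)) ->
  (forall l, 0 < l -> \forall x \near F, D (l * x)) ->
  (forall x, D x -> 0 < x) ->
  (\forall x \near F, 0 < f x) ->
  (0 <= a)%E -> ratio_index F f a -> ratio_index G g a^-1.
Proof.
move=> fmono gK gF imG domF D0 posF a0 ria l l0.
have fgpos : \forall y \near G, 0 < f (g y) by exact: (gF _ posF).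
have imG1 : \forall y \near G, (f @` D) y.
  by apply: filterS (imG _ ltr01) => y; rewrite mul1r.
have gpos : \forall y \near G, 0 < g y /\ 0 < f (g y).
  by near=> y; split; [apply: D0; apply: (gK y _).1|]; near: y.
(* At l = 1 the ratio is constantly 1; elsewhere the exponents can be compared. *)
have [l1|ln1] := eqVneq l 1.
  rewrite l1 (_ : epowR 1 a^-1 = 1%E); last first.
    by case: (a^-1)%E => [r| |] /=; rewrite ?powR1// ltxx eqxx.
  apply: cvg_near_cst; near=> y; rewrite mul1r divff // gt_eqF //.
  by have [] : 0 < g y /\ 0 < f (g y) by near: y.
apply/cvg_EFin_ltP; split=> c Lc.
  have [c0 lc] := epowR_lt_inv l0 ln1 a0 Lc.
  have [_ /(_ _ lc) up] := (cvg_EFin_ltP _ _ _).1 (ria _ c0).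
  have upG : \forall y \near G, l < f (c * g y) / f (g y) by exact: (gF _ up).
  have DG : \forall y \near G, D (c * g y) by exact: (gF _ (domF _ c0)).
  near=> y.
  have [gy0 fgy0] : 0 < g y /\ 0 < f (g y) by near: y.
  rewrite ltr_pdivrMr //.
  have [|Dgy fgy] := gK y; first by near: y.
  have [|Dgly fgly] := gK (l * y); first by near: y; exact: imG.
  have Dc : D (c * g y) by near: y.
  have lt1 : l * f (g y) < f (c * g y).
    by rewrite -ltr_pdivlMr //; near: y.
  rewrite ltNge; apply/negP; rewrite le_eqVlt => /predU1P[E|E].
    by move: lt1; rewrite E fgly fgy ltxx.
  by have := lt_trans lt1 (fmono _ _ Dc Dgly E); rewrite fgly fgy ltxx.
have [c0|c0] := leP c 0.
  near=> y; apply: le_lt_trans c0 _.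
  have [gy0 _] : 0 < g y /\ 0 < f (g y) by near: y.
  rewrite divr_gt0 //.
  have [|/D0] := gK (l * y); last by [].
  by near: y; exact: imG.
have lc := epowR_gt_inv l0 ln1 a0 c0 Lc.
have [/(_ _ lc) up _] := (cvg_EFin_ltP _ _ _).1 (ria _ c0).
have upG : \forall y \near G, f (c * g y) / f (g y) < l by exact: (gF _ up).
have DG : \forall y \near G, D (c * g y) by exact: (gF _ (domF _ c0)).
near=> y.
have [gy0 fgy0] : 0 < g y /\ 0 < f (g y) by near: y.
rewrite ltr_pdivlMr //.
have [|Dgy fgy] := gK y; first by near: y.
have [|Dgly fgly] := gK (l * y); first by near: y; exact: imG.
have Dc : D (c * g y) by near: y.
have lt1 : f (c * g y) < l * f (g y).
  by rewrite -ltr_pdivrMr //; near: y.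
rewrite ltNge; apply/negP; rewrite le_eqVlt => /predU1P[E|E].
  by move: lt1; rewrite -E fgly fgy ltxx.
by have := lt_trans (fmono _ _ Dgly Dc E) lt1; rewrite fgly fgy ltxx.
Unshelve. all: by end_near. Qed.

Lemma cvg_invM_at_right (R : realType) (l : R) : 0 < l ->
  (l * t)^-1 @[t --> +oo] --> (0 : R)^'+.
Proof.
move=> l0 A [e /= e0 eA]; suff : \forall t \near +oo, A (l * t)^-1 by [].
near=> t.
have t0 : 0 < t by near: t; exact: nbhs_pinfty_gt (num_real _).
apply: eA; last by rewrite invr_gt0 mulr_gt0.
rewrite /ball_ /= sub0r normrN gtr0_norm ?invr_gt0 ?mulr_gt0 //.
rewrite invf_plt ?posrE ?mulr_gt0 // -ltr_pdivrMl //.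
by near: t; exact: nbhs_pinfty_gt (num_real _).
Unshelve. all: by end_near. Qed.

(** Passing from 0 to infinity by inverting both the argument and the value keeps
the index: the new ratio at t is the old one at 1 / (l t). *)
Lemma ratio_index_invV (R : realType) (g : R -> R) (a : \bar R) :
  ratio_index 0^'+ g a -> ratio_index +oo (fun t => (g t^-1)^-1) a.
Proof.
move=> ga l l0.
have := cvg_comp _ _ (cvg_invM_at_right l0) (ga l l0).
apply: cvg_trans; apply: near_eq_cvg; near=> t => /=.
by rewrite invrK mulrC invfM mulrA divff ?mul1r ?gt_eqF.
Unshelve. all: by end_near. Qed.

(** * L'Hopital's rule and growth of powers at infinity *)

Lemma ge0_derive_le (R : realType) (f h : R -> R) (a b : R) :
  a <= b -> (forall x, a <= x <= b -> is_derive x 1 f (h x)) ->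
  (forall x, a <= x <= b -> 0 <= h x) -> f a <= f b.
Proof.
move=> ab df h0.
have [||c] := @MVT_segment R f h a b ab.
- by move=> x; rewrite in_itv /= => /andP[ax xb]; apply: df; rewrite !ltW.
- apply: derivable_within_continuous => x; rewrite in_itv /= => xab.
  by have := df x xab; case.
rewrite in_itv /= => cab fE; rewrite -subr_ge0 fE mulr_ge0 ?subr_ge0 //.
exact: h0.
Qed.

(** One half of the rule: f1 - c f2 is eventually nondecreasing, hence bounded
below, and its lower bound is negligible with respect to f2. *)
Lemma lhopital_pinfty_gt (R : realType) (f1 f2 h1 h2 : R -> R) (c c' : R) :
  (\forall x \near +oo, is_derive (x : R) 1 f1 (h1 x)) ->
  (\forall x \near +oo, is_derive (x : R) 1 f2 (h2 x)) ->
  (\forall x \near +oo, 0 < h2 x) ->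
  f2 x @[x --> +oo] --> +oo ->
  c' < c -> (\forall x \near +oo, c < h1 x / h2 x) ->
  \forall x \near +oo, c' < f1 x / f2 x.
Proof.
move=> df1 df2 h20 f2oo cc hc.
have [X [_ hX]] : \forall X \near +oo, [/\ is_derive (X : R) 1 f1 (h1 X),
    is_derive X 1 f2 (h2 X), 0 < h2 X & c < h1 X / h2 X].
  by near=> x; split; near: x.
have hX1 x : X + 1 <= x -> [/\ is_derive x 1 f1 (h1 x),
    is_derive x 1 f2 (h2 x), 0 < h2 x & c < h1 x / h2 x].
  by move=> Xx; apply: hX; apply: lt_le_trans Xx; rewrite ltrDl.
pose K := f1 (X + 1) - c * f2 (X + 1).
have lin x : X + 1 <= x -> c * f2 x + K <= f1 x.
  move=> Xx; suff : K <= f1 x - c * f2 x by rewrite lerBrDl.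
  have -> : f1 x - c * f2 x = (f1 - c \*: f2) x by [].
  have -> : K = (f1 - c \*: f2) (X + 1) by [].
  apply: (@ge0_derive_le _ _ (fun x => h1 x - c *: h2 x)) => // y /andP[/hX1[]].
    by move=> d1 d2 _ _ _; apply: is_deriveB.
  move=> _ _ h2y ch _; rewrite subr_ge0 ltW //.
  by rewrite -ltr_pdivlMr.
near=> x.
have f2x0 : 0 < f2 x by near: x; exact: (cvgryPgt _).1.
rewrite ltr_pdivlMr //; apply: lt_le_trans (lin x _); last first.
  by near: x; exact: nbhs_pinfty_ge (num_real _).
rewrite -subr_gt0 addrAC -mulrBl -ltrBlDr sub0r mulrC -ltr_pdivrMr ?subr_gt0//.
by near: x; exact: (cvgryPgt _).1.
Unshelve. all: by end_near. Qed.

(** L'Hopital's rule for infinity over infinity; infinite limits [L] are those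
that occur under rapid variation. *)
Lemma lhopital_pinfty (R : realType) (f1 f2 h1 h2 : R -> R) (L : \bar R) :
  (\forall x \near +oo, is_derive (x : R) 1 f1 (h1 x)) ->
  (\forall x \near +oo, is_derive (x : R) 1 f2 (h2 x)) ->
  (\forall x \near +oo, 0 < h2 x) ->
  f2 x @[x --> +oo] --> +oo ->
  (h1 x / h2 x)%:E @[x --> +oo] --> L -> (f1 x / f2 x)%:E @[x --> +oo] --> L.
Proof.
move=> df1 df2 h20 f2oo /cvg_EFin_ltP[up lo].
have dense (a : R) (M : \bar R) : (a%:E < M)%E -> exists2 b : R, a < b & (b%:E < M)%E.
  case: M => [r| |//]; last by exists (a + 1); rewrite ?ltrDl ?ltry.
  by rewrite lte_fin => ar; exists ((a + r) / 2); rewrite ?lte_fin ?midf_lt.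
apply/cvg_EFin_ltP; split=> c.
  (* the upper half is the lower half for - f1 *)
  rewrite -lteN2 -EFinN => /dense[b cb bL].
  have := @lhopital_pinfty_gt _ (- f1) f2 (fun x => - h1 x) h2 _ _ _ df2 h20 f2oo cb.
  case.
  - by near do apply: is_deriveN.
  - apply: filterS (up (- b) _); last by rewrite -lteN2 -EFinN opprK.
    by move=> x; rewrite mulNr ltrNr.
  - move=> X [Xr hX]; exists X; split => // x /hX.
    by rewrite fctE mulNr ltrN2.
by move=> /dense[b cb /lo lb]; apply: lhopital_pinfty_gt df1 df2 h20 f2oo cb lb.
Unshelve. all: by end_near. Qed.

(** The derivative of t |-> f(l t) divided by that of f is l^-1 g(l s) / g(s) with
s = (l t)^-1; L'Hopital's rule transfers its limit l^-1 l^a = l^(a - 1) to the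
ratio f(l t) / f(t). *)
Lemma ratio_index_primitive (R : realType) (f g : R -> R) (a : \bar R) :
  (\forall s \near 0^'+, 0 < g s) ->
  (\forall t \near +oo, is_derive (t : R) 1 f (t ^- 2 / g t^-1)) ->
  f t @[t --> +oo] --> +oo ->
  ratio_index 0^'+ g a -> ratio_index +oo f (a - 1).
Proof.
move=> g0 df foo ga l l0.
have scale : l * t @[t --> +oo] --> +oo.
  by apply: gt0_cvgMry => //; exact: cvg_id.
have gV0 : \forall t \near +oo, 0 < g t^-1.
  have gV1 : \forall t \near +oo, 0 < g (1 * t)^-1 := cvg_invM_at_right ltr01 g0.
  by apply: filterS gV1 => t; rewrite mul1r.
have h0 : \forall t \near +oo, 0 < t ^- 2 / g t^-1.
  near=> t; rewrite divr_gt0 //; last by near: t.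
  by rewrite invr_gt0 exprn_gt0 //; near: t; exact: nbhs_pinfty_gt (num_real _).
apply: (@lhopital_pinfty _ (f \o *%R l) f (fun t => (l * t) ^- 2 / g (l * t)^-1 * l)
  (fun t => t ^- 2 / g t^-1)) => //.
  have dfl : \forall t \near +oo, is_derive (l * t) 1 f ((l * t) ^- 2 / g (l * t)^-1) :=
    scale _ df.
  apply: filterS dfl => t dft.
  apply: (@is_derive1_comp _ f ( *%R l) t _ l dft).
  have := @is_deriveZ R R R id l t 1 1 (is_derive_id _ _).
  by rewrite [l *: 1]mulr1.
have gi := ratio_index_invV ga l0.
rewrite -epowRB1 //.
have := @cvgeZl _ _ _ _ _ (l^-1)%:E isT gi.
apply: cvg_trans; apply: near_eq_cvg; near=> t.
have t0 : 0 < t by near: t; exact: nbhs_pinfty_gt (num_real _).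
have gt0 : 0 < g t^-1 by near: t.
have glt0 : 0 < g (l * t)^-1 by near: t; exact: (scale _ gV0).
by rewrite -EFinM; congr EFin; field; rewrite !gt_eqF.
Unshelve. all: by end_near. Qed.

(** Doubling x multiplies f by at least 2^r, like a power; a lower bound on one
interval [X, 2 X] then propagates to all larger arguments. The exponent may
have either sign. *)
Lemma power_growth (R : realType) (f : R -> R) (r : R) :
  (\forall x \near +oo, 2 `^ r * f x <= f (2 * x)) ->
  (\forall x \near +oo, exists2 m, 0 < m & forall y, x <= y <= 2 * x -> m <= f y) ->
  exists2 c, 0 < c & \forall x \near +oo, c * x `^ r <= f x.
Proof.
move=> dbl lb.
have [X0 [_ hX0]] : \forall x \near +oo, [/\ 0 < x, 2 `^ r * f x <= f (2 * x) &
    exists2 m, 0 < m & forall y, x <= y <= 2 * x -> m <= f y].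
  by near=> x; split; near: x => //; exact: nbhs_pinfty_gt (num_real _).
pose X := X0 + 1.
have hX x : X <= x -> 2 `^ r * f x <= f (2 * x).
  by move=> Xx; have [] := hX0 x; first by apply: lt_le_trans Xx; rewrite ltrDl.
have [Xp _ [m m0 hm]] : [/\ 0 < X, 2 `^ r * f X <= f (2 * X) &
    exists2 m, 0 < m & forall y, X <= y <= 2 * X -> m <= f y].
  by apply: hX0; rewrite ltrDl.
(* M bounds x^r on [X, 2 X] whatever the sign of r *)
pose M := X `^ r + (2 * X) `^ r.
have M0 : 0 < M by rewrite addr_gt0 // powR_gt0 // mulr_gt0.
have hM y : X <= y <= 2 * X -> y `^ r <= M.
  move=> /andP[Xy yX]; have y0 : 0 < y by exact: lt_le_trans Xy.
  have [r0|r0] := leP 0 r.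
    by rewrite ler_wpDl ?powR_ge0 // ge0_ler_powR // nnegrE ltW // mulr_gt0.
  rewrite ler_wpDr ?powR_ge0 // -(opprK r) powRN [X in _ <= X]powRN.
  rewrite lef_pV2 ?posrE ?powR_gt0 //.
  apply: ge0_ler_powR => //; rewrite ?nnegrE ?oppr_ge0; exact: ltW.
exists (m / M); first exact: divr_gt0.
have key n x : X <= x <= 2 ^+ n.+1 * X -> m / M * x `^ r <= f x.
  elim: n x => [|n IH] x.
    rewrite expr1 => xX; apply: le_trans (hm _ xX).
    by rewrite mulrAC ler_pdivrMr // ler_pM2l // hM.
  move=> /andP[Xx xX]; have [x2|x2] := leP x (2 ^+ n.+1 * X).
    by apply: IH; rewrite Xx.
  have x0 : 0 < x by exact: lt_le_trans Xx.
  have Xx2 : X <= x / 2.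
    rewrite ler_pdivlMr //; apply: le_trans (ltW x2).
    by rewrite mulrC ler_pM2r // exprS ler_peMr // exprn_ege1 // ler1n.
  have -> : x = 2 * (x / 2) by field.
  apply: le_trans (hX _ Xx2).
  rewrite powRM ?divr_ge0 ?(ltW x0) // mulrCA ler_pM2l ?powR_gt0 //.
  apply: IH; rewrite Xx2 /= ler_pdivrMr // mulrAC -exprSr //.
near=> x.
have Xx : X <= x by near: x; exact: nbhs_pinfty_ge (num_real _).
apply: (key (Num.truncn (x / X))); rewrite Xx /= -ler_pdivrMr //.
have xX0 : 0 <= x / X by rewrite divr_ge0 ?ltW // (lt_le_trans Xp).
apply: ltW; apply: lt_le_trans (_ : (Num.truncn (x / X)).+1%:R <= _).
  by rewrite truncnS_gt.
by rewrite -natrX ler_nat ltnW // ltn_expl.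
Unshelve. all: by end_near. Qed.

(** * The error bound dominates the identity near zero *)

Section SetDist.
Context (R : realType) (E : normedModType R).
Implicit Types (x y : E) (D : set E).

Lemma set_dist_le x y D : D y -> set_dist x D <= `|x - y|.
Proof.
by move=> Dy; apply: ge_inf; [exists 0 => _ [z _ <-]|exists y].
Qed.

Lemma le_set_dist x D (e : R) :
  D !=set0 -> (forall y, D y -> e <= `|x - y|) -> e <= set_dist x D.
Proof.
move=> [y Dy] eD; apply: lb_le_inf; first by exists `|x - y|, y.
by move=> _ [z Dz <-]; exact: eD.
Qed.

Lemma set_dist_ge0 x D : D !=set0 -> 0 <= set_dist x D.
Proof. by move=> D0; apply: le_set_dist. Qed.

Lemma set_dist_subset x D D' :
  D !=set0 -> D `<=` D' -> set_dist x D' <= set_dist x D.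
Proof. by move=> D0 DD'; apply: le_set_dist => // y /DD' /set_dist_le. Qed.

Lemma set_dist_gt0 x D : D !=set0 -> closed D -> ~ D x -> 0 < set_dist x D.
Proof.
move=> D0 Dcl Dx.
have /nbhs_ballP[e /= e0 eD] : nbhs x (~` D).
  by apply: open_nbhs_nbhs; split => //; exact: closed_openC.
apply: lt_le_trans e0 _; apply: le_set_dist => // y Dy.
rewrite leNgt; apply/negP => xy; apply: (eD y) Dy.
by rewrite -ball_normE.
Qed.

Lemma set_dist_lip x y D : D !=set0 -> set_dist x D <= set_dist y D + `|x - y|.
Proof.
move=> D0; rewrite -lerBlDr; apply: le_set_dist => // z Dz.
rewrite lerBlDr (le_trans (set_dist_le x Dz)) //.
by rewrite [leRHS]addrC ler_distD.
Qed.

Lemma continuous_set_dist D : D !=set0 -> continuous (fun x => set_dist x D).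
Proof.
move=> D0 x; apply/cvgrPdist_lt => e e0; near=> y.
have xy : `|x - y| < e by near: y; exact: cvgr_dist_lt.
apply: le_lt_trans xy; rewrite ler_norml lerBlDl set_dist_lip // andbT.
by rewrite lerBrDl lerBlDr distrC set_dist_lip.
Unshelve. all: by end_near. Qed.

(** Strict convexity of the squared norm, in quantitative form. *)
Lemma norm_convex_comb (dot : {dot E for (@idfun R)})
    (dot_norm : forall x, `|x| ^+ 2 = dot x x) x y (l : R) :
  `|(1 - l) *: x + l *: y| ^+ 2 =
  (1 - l) * `|x| ^+ 2 + l * `|y| ^+ 2 - l * (1 - l) * `|x - y| ^+ 2.
Proof.
rewrite !dot_norm.
have DL u v w : dot (u + v) w = dot u w + dot v w by exact: (linearDl dot).
have DR u v w : dot w (u + v) = dot w u + dot w v by exact: (linearDr dot).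
have NL u w : dot (- u) w = - dot u w by exact: (linearNl dot).
have NR u w : dot w (- u) = - dot w u by exact: (linearNr dot).
have ZL a u w : dot (a *: u) w = a * dot u w by exact: (linearZl_LR dot).
have ZR a u w : dot w (a *: u) = a * dot w u by exact: (linearZr_LR dot).
by rewrite !(DL, DR, NL, NR, ZL, ZR); ring.
Qed.

End SetDist.

(** Every small t > 0 is the distance to C of a point x with norm at most kappa;
there max_i dist(x, C_i) <= dist(x, C) = t, and the error bound reads
t <= Phi(t, kappa). The points are taken on a segment from x0 to some p in C
with norm less than kappa + eta: the strict convexity of the norm keeps the
segment in the ball of radius kappa except on a final part whose length
tends to 0 with eta, so that dist(0, C) matters only as an infimum. *)
Lemma error_bound_ge_id (R : realType) (E : normedModType R)
    (dot : {dot E for (@idfun R)})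
    (dot_norm : forall x : E, `|x| ^+ 2 = dot x x)
    (m : nat) (Cs : 'I_m -> set E)
    (Cs_closed : forall i, closed (Cs i))
    (C_neq0 : \bigcap_i Cs i !=set0)
    (Phi : R -> R -> R)
    (Phi_bound : consistent_error_bound Cs Phi)
    (kappa : R) (x0 : E)
    (x0_notin_C : ~ (\bigcap_i Cs i) x0)
    (kappa_ge : Num.max (set_dist 0 (\bigcap_i Cs i)) `|x0| <= kappa) :
  exists2 t0, 0 < t0 & forall t, 0 < t <= t0 -> t <= Phi t kappa.
Proof.
set C := \bigcap_i Cs i in C_neq0 x0_notin_C kappa_ge *.
have [_ bnd mono1 mono2] := Phi_bound.
move: kappa_ge; rewrite ge_max => /andP[dist0k x0k].
have k0 : 0 <= kappa by exact: le_trans x0k.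
have Ccl : closed C by apply: closed_bigI => i _; exact: Cs_closed.
pose d := set_dist x0 C.
have d0 : 0 < d by exact: set_dist_gt0.
exists d => // t /andP[t0 td].
have k21 : 0 < 2 * kappa + 1 by rewrite ltr_wpDl // mulr_ge0.
(* th is the proportion of the segment left out near p; the distance to C at
   the cut is at most th |x0 - p| <= th (2 kappa + 1) <= t *)
pose th := Num.min 1 (t / (2 * kappa + 1)).
have th0 : 0 < th by rewrite lt_min ltr01 divr_gt0.
have th1 : th <= 1 by rewrite ge_min lexx.
have tht : th * (2 * kappa + 1) <= t.
  by rewrite -ler_pdivlMr // ge_min lexx orbT.
(* the excess (kappa + eta)^2 - kappa^2 <= eta (2 kappa + 1) must not exceed the
   gain th d^2 due to strict convexity *)
pose eta := Num.min 1 (th * d ^+ 2 / (2 * kappa + 1)).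
have eta0 : 0 < eta by rewrite lt_min ltr01 divr_gt0 // mulr_gt0 // exprn_gt0.
have eta1 : eta <= 1 by rewrite ge_min lexx.
have etath : eta * (2 * kappa + 1) <= th * d ^+ 2.
  by rewrite -ler_pdivlMr // ge_min lexx orbT.
have [_ [p Cp <-]] : exists2 r, [set `|0 - y| | y in C] r & r < kappa + eta.
  apply: inf_lt; first by case: C_neq0 => y Cy; exists `|0 - y|, y.
  by rewrite (le_lt_trans dist0k) // ltrDl.
rewrite sub0r normrN => pk.
pose x l := (1 - l) *: x0 + l *: p.
have dC : d <= `|x0 - p| by exact: set_dist_le.
have [|||c] := @IVT R (fun l => set_dist (x l) C) 0 (1 - th) t.
- by rewrite subr_ge0.
- apply: continuous_subspaceT => l.
  apply: (@continuous_comp _ _ _ x (fun y => set_dist y C)); last first.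
    exact: continuous_set_dist.
  apply: cvgD; apply: cvgZ; try exact: cvg_cst; last exact: cvg_id.
  by apply: cvgB; [exact: cvg_cst|exact: cvg_id].
- rewrite ge_min le_max {3}/x subr0 scale1r scale0r addr0 td andbT.
  apply/orP; right; apply: le_trans tht.
  apply: le_trans (set_dist_le _ Cp) _.
  have -> : x (1 - th) - p = th *: (x0 - p).
    by rewrite /x subKr scalerBl scale1r scalerBr -addrA [_ - p]addrAC subrr sub0r.
  rewrite normrZ (gtr0_norm th0) ler_pM2l //.
  apply: le_trans (ler_normB _ _) _.
  by move: pk x0k eta1; lra.
rewrite in_itv /= => /andP[c0 cth] xct.
have xck : `|x c| <= kappa.
  rewrite -(ler_pXn2r (ltn0Sn 1)) ?nnegrE // (norm_convex_comb dot_norm).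
  have x02 : `|x0| ^+ 2 <= kappa ^+ 2 by rewrite ler_pXn2r ?nnegrE.
  have p2 : `|p| ^+ 2 <= kappa ^+ 2 + th * d ^+ 2.
    apply: le_trans (_ : (kappa + eta) ^+ 2 <= _).
      by rewrite ler_pXn2r ?nnegrE ?addr_ge0 ?(ltW pk) ?(ltW eta0).
    by nra.
  have d2 : d ^+ 2 <= `|x0 - p| ^+ 2 by rewrite ler_pXn2r ?nnegrE // ltW.
  have c1 : c <= 1 by lra.
  have h1 : (1 - c) * `|x0| ^+ 2 <= (1 - c) * kappa ^+ 2.
    by rewrite ler_wpM2l // subr_ge0.
  have h2 : c * `|p| ^+ 2 <= c * (kappa ^+ 2 + th * d ^+ 2) by rewrite ler_wpM2l.
  have h3 : c * (1 - c) * d ^+ 2 <= c * (1 - c) * `|x0 - p| ^+ 2.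
    by rewrite ler_wpM2l // mulr_ge0 // subr_ge0.
  have h4 : c * (th * d ^+ 2) <= c * ((1 - c) * d ^+ 2).
    by rewrite ler_wpM2l // ler_wpM2r ?exprn_ge0 ?(ltW d0) //; lra.
  by move: h1 h2 h3 h4; lra.
rewrite -{1}xct; apply: le_trans (bnd (x c)) _.
have t0' : 0 <= t by exact: ltW.
apply: (@le_trans _ _ (Phi t `|x c|)).
  have [mono_a _ _] := mono1 _ (normr_ge0 (x c)).
  apply: mono_a; rewrite ?in_itv /= ?andbT //.
    apply: (big_ind (fun r : R => 0 <= r)) => // [a b a0 _|i _].
      by rewrite le_max a0.
    by apply: set_dist_ge0; case: C_neq0 => y Cy; exists y; exact: Cy.
  apply: bigmax_le => // i _; rewrite -xct; apply: set_dist_subset => //.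
  by move=> y; apply.
by apply: mono2; rewrite ?in_itv /= ?andbT.
Qed.

(** * The generalized inverse and the derivative of an integral *)

(** What makes phi an increasing bijection from [0, +oo) onto its range. The last
clause is the intermediate value property; for a monotone function it amounts
to continuity, and it is stable under the change of variables that produces phi. *)
Definition increasing_bijection (R : realType) (phi : R -> R) : Prop :=
  [/\ phi 0 = 0,
      forall s t, 0 <= s -> s < t -> phi s < phi t
    & forall v s, 0 <= v -> 0 <= s <= phi v -> exists2 t, 0 <= t & phi t = s].

Lemma increasing_phi_of (R : realType) (kappa : R) (Phi : R -> R -> R) :
  (forall a, 0 <= a -> 0 <= Phi a kappa) -> Phi 0 kappa = 0 ->
  {in `[0, +oo[ &, {homo Phi^~ kappa : s t / s < t}} ->
  {within `[0, +oo[, continuous (Phi^~ kappa)} ->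
  increasing_bijection (phi_of kappa Phi).
Proof.
move=> P0 Pz Pmono Pcont; split.
- by rewrite /phi_of sqrtr0 Pz expr0n.
- move=> s t s0 st; have t0 : 0 < t by exact: le_lt_trans st.
  rewrite /phi_of ltr_pXn2r ?nnegrE ?P0 ?sqrtr_ge0 //.
  by apply: Pmono; rewrite ?in_itv /= ?sqrtr_ge0 // ltr_sqrt.
- move=> v s v0 /andP[s0 sv].
  have [|||c] := @IVT R (Phi^~ kappa) 0 (Num.sqrt v) (Num.sqrt s).
  + exact: sqrtr_ge0.
  + apply: continuous_subspaceW Pcont => x /=; rewrite !in_itv /= andbT.
    by move=> /andP[].
  + rewrite Pz ge_min le_max sqrtr_ge0 /=; apply/orP; right.
    rewrite -(ler_pXn2r (ltn0Sn 1)) ?nnegrE ?sqrtr_ge0 ?P0 ?sqrtr_ge0 //.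
    by rewrite sqr_sqrtr.
  rewrite in_itv /= => /andP[c0 cv] Pc; exists (c ^+ 2); first exact: exprn_ge0.
  by rewrite /phi_of sqrtr_sqr ger0_norm // Pc sqr_sqrtr.
Qed.

Section IncreasingBijection.
Context (R : realType) (phi : R -> R) (phiP : increasing_bijection phi).

Lemma incr_bij_ltE s t : 0 <= s -> 0 <= t -> (phi s < phi t) = (s < t).
Proof.
have [_ mono _] := phiP; move=> s0 t0; case: (ltgtP s t) => [st|ts|->].
- exact: mono.
- by apply/negbTE; rewrite -leNgt ltW // mono.
- exact: ltxx.
Qed.

Lemma incr_bij_gt0 t : 0 < t -> 0 < phi t.
Proof. by have [z mono _] := phiP; rewrite -{2}z; exact: mono. Qed.

(** On values of phi the infimum defining the generalized inverse is that of a
half-line [t, +oo). *)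
Lemma gen_invK t : 0 <= t -> gen_inv phi (phi t) = t.
Proof.
move=> t0; rewrite /gen_inv.
rewrite (_ : mkset _ = `[t, +oo[%classic); first by rewrite inf_itv.
apply/seteqP; split=> u /=; rewrite in_itv /= andbT.
  by move=> [u0]; rewrite leNgt incr_bij_ltE // -leNgt.
by move=> tu; split; rewrite ?leNgt ?incr_bij_ltE // -?leNgt // (le_trans t0).
Qed.

Lemma incr_bij_preimage v s : 0 <= v -> 0 < s <= phi v ->
  exists2 t, 0 < t & phi t = s.
Proof.
have [z _ ivp] := phiP; move=> v0 /andP[s0 sv].
have [|t t0 E] := ivp v s v0; first by rewrite ltW.
exists t => //; rewrite lt_neqAle t0 andbT; apply/eqP => t0E.
by move: s0; rewrite -E -t0E z ltxx.
Qed.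

Lemma continuous_gen_inv t : 0 < t -> {for phi t, continuous (gen_inv phi)}.
Proof.
move=> t0; apply/cvgrPdist_lt => e e0; rewrite gen_invK ?(ltW t0) //.
pose a := Num.max 0 (t - e).
have a0 : 0 <= a by rewrite le_max lexx.
have at_ : a < t by rewrite gt_max t0 ltrBlDr ltrDl.
have te0 : 0 <= t + e by rewrite addr_ge0 // ltW.
near=> s.
have as_ : phi a < s.
  by near: s; apply: lt_nbhsr; rewrite incr_bij_ltE // ltW.
have st : s < phi (t + e).
  by near: s; apply: lt_nbhsl; rewrite incr_bij_ltE ?ltrDl // ltW.
have [|u u0 us] := @incr_bij_preimage (t + e) s te0.
  rewrite ltW ?andbT //; apply: le_lt_trans as_.
  by have [z _ _] := phiP; rewrite -z leNgt incr_bij_ltE // -leNgt.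
rewrite -us gen_invK ?(ltW u0) //.
move: as_ st; rewrite -us !incr_bij_ltE ?(ltW u0) //.
by rewrite ltr_distl gt_max ltrBlDr => /andP[_ ->]; rewrite ltrBlDr => ->.
Unshelve. all: by end_near. Qed.

(** The range of phi contains a right neighbourhood of 0, on which the preimages
are small. *)
Lemma near0_preimage v : 0 < v ->
  \forall s \near 0^'+, exists2 u, 0 < u < v & phi u = s.
Proof.
move=> v0; near=> s.
have s0 : 0 < s by [].
have sv : s < phi v by near: s; apply: nbhs_right_lt; exact: incr_bij_gt0.
have [|u u0 us] := @incr_bij_preimage v s (ltW v0); first by rewrite s0 ltW.
by exists u => //; rewrite u0 -incr_bij_ltE ?(ltW u0) ?(ltW v0) // us.
Unshelve. all: by end_near. Qed.

Lemma cvg_gen_inv0 : gen_inv phi s @[s --> 0^'+] --> (0 : R)^'+.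
Proof.
move=> A [e /= e0 eA].
suff : \forall s \near 0^'+, A (gen_inv phi s) by [].
apply: filterS (near0_preimage e0) => s [u /andP[u0 ue] <-].
rewrite gen_invK ?(ltW u0) //; apply: eA => //.
by rewrite /ball_ /= sub0r normrN gtr0_norm.
Qed.

End IncreasingBijection.

Lemma open_nbhs_ends (R : realType) (D : set R) (x : R) :
  open D -> D x -> exists2 e, 0 < e & D (x - e) /\ D (x + e).
Proof.
move=> oD Dx; have /nbhs_ballP[e /= e0 eD] : nbhs x D by exact: open_nbhs_nbhs.
exists (e / 2); first by rewrite divr_gt0.
have e2 : `|e / 2| < e by rewrite gtr0_norm ?divr_gt0 // ltr_pdivrMr // ltr_pMr // ltr1n.
split; apply: eD; rewrite -ball_normE /ball_ /=.
  by rewrite opprB addrCA subrr addr0.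
by rewrite opprD addrA subrr sub0r normrN.
Qed.

(** Near t the oriented integral differs by a constant from an integral with a
fixed left endpoint a < t, to which the fundamental theorem of calculus applies. *)
Lemma is_derive_oriented_integral (R : realType) (f : R -> R) (D : set R) (d0 t : R) :
  is_interval D -> open D -> (forall x, D x -> {for x, continuous f}) ->
  D d0 -> D t -> is_derive t 1 (oriented_integral f d0) (f t).
Proof.
move=> iD oD fc Dd0 Dt.
have [e1 e10 [De1 De1']] := open_nbhs_ends oD Dd0.
have [e2 e20 [De2 De2']] := open_nbhs_ends oD Dt.
pose a := Num.min (d0 - e1) (t - e2).
pose u := Num.max (d0 + e1) (t + e2).
have Da : D a by rewrite /a; case: (leP (d0 - e1)).
have Du : D u by rewrite /u; case: (leP (d0 + e1)).
have at_ : a < t by rewrite /a gt_min orbC ltrBlDr ltrDl e20.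
have ad : a < d0 by rewrite /a gt_min ltrBlDr ltrDl e10.
have tu : t < u by rewrite /u lt_max orbC ltrDl e20.
have du : d0 < u by rewrite /u lt_max ltrDl e10.
have int : lebesgue_measure.-integrable `[a, u] (EFin \o f).
  apply: continuous_compact_integrable; first exact: segment_compact.
  apply: continuous_in_subspaceT => x; rewrite inE /= in_itv /= => /andP[ax xu].
  by apply: fc; apply: (iD a u) => //; rewrite ax.
have intS v w : a <= v -> w <= u ->
    lebesgue_measure.-integrable `[v, w] (EFin \o f).
  move=> av wu; apply: integrableS int => //.
  by move=> x /=; rewrite !in_itv /= => /andP[vx xw]; rewrite (le_trans av) //= (le_trans xw).
pose F x := \int[lebesgue_measure]_(s in `[a, x]) f s.
have [dF F't] := continuous_FTC1_closed tu int at_ (fc _ Dt).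
have F' : is_derive t 1 F (f t) by apply: DeriveDef => //; rewrite -derive1E.
have F'2 : is_derive t 1 (F - cst (F d0)) (f t).
  by rewrite -[f t]subr0; apply: is_deriveB.
apply: near_eq_is_derive F'2; near=> x.
have ax : a < x by near: x; exact: lt_nbhsr.
have xu : x < u by near: x; exact: lt_nbhsl.
have split_int v w : a <= v -> v <= w -> w <= u ->
    F w - F v = \int[lebesgue_measure]_(s in `[v, w]) f s.
  move=> av vw wu; rewrite /F Rintegral_itvB ?bnd_simp //; last exact: intS.
  rewrite Rintegral_itv_obnd_cbnd //; apply: integrableS (intS v w av wu) => //.
  exact: subset_itv_oc_cc.
rewrite /oriented_integral fctE /cst; case: ifPn => [dx|].
  by rewrite split_int // ltW.
by rewrite -ltNge => xd; rewrite -opprB split_int // ltW.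
Unshelve. all: by end_near. Qed.

(** * The primitive of the inverse, and inversion at infinity *)

Section Spade.
Context (R : realType) (kappa : R) (Phi : R -> R -> R).
Context (phiP : increasing_bijection (phi_of kappa Phi)).
Local Notation phi := (phi_of kappa Phi).
Local Notation g := (gen_inv phi).

(** The interval (0, sup phi) is the range of phi on (0, +oo). *)
Lemma spade_domP t : spade_dom kappa Phi t <-> exists2 u, 0 < u & phi u = t.
Proof.
split=> [[t0 /ereal_sup_gt[_ [v /= v0 <-]]]|[u u0 <-]].
  rewrite lte_fin => tv; apply: (incr_bij_preimage phiP (v := v)).
    by move: v0; rewrite in_itv /= andbT.
  by rewrite t0 ltW.
split; first exact: incr_bij_gt0.
apply: (@lt_le_trans _ _ (phi (u + 1))%:E).
  by rewrite lte_fin incr_bij_ltE ?ltrDl ?addr_ge0 // ltW.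
apply: ereal_sup_ubound; exists (u + 1) => //=.
by rewrite in_itv /= andbT addr_ge0 // ltW.
Qed.

Lemma spade_dom_interval : is_interval (spade_dom kappa Phi).
Proof.
move=> a b [a0 _] /spade_domP[u u0 ub] x /andP[ax xb].
apply/spade_domP; apply: (incr_bij_preimage phiP (ltW u0)).
by rewrite ub xb andbT (lt_le_trans a0).
Qed.

Lemma spade_dom_open : open (spade_dom kappa Phi).
Proof.
rewrite openE => t /spade_domP[u u0 <-].
have u1 : phi u < phi (u + 1).
  by rewrite incr_bij_ltE ?ltrDl ?addr_ge0 // ltW.
have := @near_in_itvoo _ 0 (phi (u + 1)) (phi u).
rewrite in_itv /= u1 incr_bij_gt0 // => /(_ isT).
apply: filterS => s; rewrite in_itv /= => /andP[s0 su].
apply/spade_domP; apply: (incr_bij_preimage phiP (v := u + 1)).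
  by rewrite addr_ge0 // ltW.
by rewrite s0 ltW.
Qed.

Lemma spade_dom_gen_inv_gt0 t : spade_dom kappa Phi t -> 0 < g t.
Proof. by move=> /spade_domP[u u0 <-]; rewrite gen_invK // ltW. Qed.

Lemma is_derive_spade d0 t : spade_dom kappa Phi d0 -> spade_dom kappa Phi t ->
  is_derive t 1 (spade kappa Phi d0) (g t)^-1.
Proof.
apply: is_derive_oriented_integral; first exact: spade_dom_interval.
  exact: spade_dom_open.
move=> x Dx; have gx := spade_dom_gen_inv_gt0 Dx.
apply: cvgV; first by rewrite gt_eqF.
by case/spade_domP : Dx => u u0 <-; exact: continuous_gen_inv.
Qed.

Lemma is_derive_Psi d0 t : spade_dom kappa Phi d0 -> Psi_dom kappa Phi t ->
  is_derive t 1 (Psi_of kappa Phi d0) (t ^- 2 / g t^-1).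
Proof.
move=> Dd0 Dt; have t0 : 0 < t by move: Dt => -[]; rewrite invr_gt0.
have dV : is_derive t 1 (fun x : R => x^-1) (- t ^- 2 *: 1).
  by apply: is_deriveV; rewrite gt_eqF.
have dPsi : is_derive t 1 (Psi_of kappa Phi d0) _ :=
  is_deriveN (is_derive1_comp (is_derive_spade Dd0 Dt) dV).
by apply: is_derive_eq dPsi _; rewrite [_ *: 1]mulr1 mulrN opprK mulrC.
Qed.

Lemma Psi_dom_gt0 t : Psi_dom kappa Phi t -> 0 < t.
Proof. by case; rewrite invr_gt0. Qed.

Lemma Psi_dom_up t t' : Psi_dom kappa Phi t -> t <= t' -> Psi_dom kappa Phi t'.
Proof.
move=> Dt tt'; have t0 := Psi_dom_gt0 Dt; have t'0 := lt_le_trans t0 tt'.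
case/spade_domP : Dt => u u0 ut; apply/spade_domP.
apply: (incr_bij_preimage phiP (ltW u0)).
by rewrite ut invr_gt0 t'0 lef_pV2.
Qed.

(** If g(s) <= s near 0, then the derivative of Psi is eventually at least 1/t,
and Psi grows at least like the logarithm. *)
Lemma cvg_Psi d0 : spade_dom kappa Phi d0 ->
  (\forall s \near 0^'+, g s <= s) ->
  Psi_of kappa Phi d0 t @[t --> +oo] --> +oo.
Proof.
move=> Dd0 gs.
have gsV : \forall t \near +oo, g (1 * t)^-1 <= (1 * t)^-1 :=
  cvg_invM_at_right ltr01 gs.
have [X [_ hX]] : \forall t \near +oo, g t^-1 <= t^-1.
  by apply: filterS gsV => t; rewrite mul1r.
have DdV : Psi_dom kappa Phi d0^-1 by rewrite /Psi_dom /= invrK.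
pose b := Num.max d0^-1 (X + 1).
have Db : Psi_dom kappa Phi b by apply: Psi_dom_up DdV _; rewrite le_max lexx.
have b0 := Psi_dom_gt0 Db.
pose f : R -> R := Psi_of kappa Phi d0.
have lnle x : b <= x -> f b - ln b <= f x - ln x.
  move=> bx; have -> : f x - ln x = (f - @ln R) x by [].
  have -> : f b - ln b = (f - @ln R) b by [].
  apply: (@ge0_derive_le _ _ (fun x => x ^- 2 / g x^-1 - x^-1)) => // y /andP[yb _].
    apply: is_deriveB; first by apply: is_derive_Psi => //; exact: Psi_dom_up yb.
    by apply: is_derive1_ln; exact: lt_le_trans yb.
  have y0 : 0 < y by exact: lt_le_trans yb.
  have Dy := spade_dom_gen_inv_gt0 (Psi_dom_up Db yb).
  rewrite subr_ge0 ler_pdivlMr // expr2 invfM ler_pM2l ?invr_gt0 //.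
  apply: hX; apply: lt_le_trans yb.
  by rewrite /b lt_max [X in _ || X]ltrDl ltr01 orbT.
apply/cvgryPge => A; near=> x.
have bx : b <= x by near: x; exact: nbhs_pinfty_ge (num_real _).
have x0 : 0 < x by exact: lt_le_trans bx.
have Ax : expR (A - (f b - ln b)) <= x.
  by near: x; exact: nbhs_pinfty_ge (num_real _).
apply: le_trans (_ : ln x + (f b - ln b) <= _); last first.
  by rewrite -lerBrDl; exact: lnle.
rewrite -lerBlDr -[leLHS]expRK; move: Ax.
by rewrite -ler_ln ?posrE ?expR_gt0.
Unshelve. all: by end_near. Qed.

End Spade.

(** A differentiable function with positive derivative on an up-closed set and
tending to infinity: its partial inverse is defined near infinity, monotone,
measurable, and tends to infinity. *)
Section InverseAtInfinity.
Context (R : realType) (D : set R) (f h : R -> R).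
Context (D_up : forall x y, D x -> x <= y -> D y).
Context (f_derive : forall x, D x -> is_derive x 1 f (h x)).
Context (h_gt0 : forall x, D x -> 0 < h x).
Context (f_oo : f x @[x --> +oo] --> +oo).
Local Notation finv := ('pinv_(fun=> 0) D f).

Lemma derive_gt0_lt x y : D x -> D y -> x < y -> f x < f y.
Proof.
move=> Dx _ xy; have D' z : x <= z -> D z by exact: D_up.
have [||c] := @MVT R f h x y xy.
- by move=> z; rewrite in_itv /= => /andP[xz _]; apply: f_derive; exact: D' (ltW _).
- apply: derivable_within_continuous => z; rewrite in_itv /= => /andP[/D' Dz _].
  by case: (f_derive Dz).
- rewrite in_itv /= => /andP[xc _] fE; rewrite -subr_gt0 fE mulr_gt0 ?subr_gt0 //.
  by apply: h_gt0; exact: D' (ltW _).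
Qed.

Lemma derive_gt0_leE x y : D x -> D y -> (f x <= f y) = (x <= y).
Proof.
move=> Dx Dy; case: (ltgtP x y) => [xy|yx|->]; last exact: lexx.
  by rewrite ltW // derive_gt0_lt.
by apply/negbTE; rewrite -ltNge derive_gt0_lt.
Qed.

Lemma derive_gt0_inj : {in D &, injective f}.
Proof.
move=> x y; rewrite !inE => Dx Dy fxy; apply/eqP.
by rewrite eq_le -(derive_gt0_leE Dx Dy) -(derive_gt0_leE Dy Dx) fxy lexx.
Qed.

Lemma derive_gt0_invK y : (f @` D) y -> D (finv y) /\ f (finv y) = y.
Proof.
move=> fDy; split; last by apply: pinvK; rewrite inE.
have [pD _ _] := injpinv_bij (fun=> 0) derive_gt0_inj.
exact: pD.
Qed.

Lemma derive_gt0_image b y : D b -> f b <= y -> (f @` D) y.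
Proof.
move=> Db fby.
have [v [bv yv]] : exists v, b <= v /\ y <= f v.
  have [v []] : \forall v \near +oo, b <= v /\ y <= f v.
    near=> v; split; near: v; last exact: (cvgryPge _).1.
    exact: nbhs_pinfty_ge (num_real _).
  by move=> _ /(_ (v + 1)); rewrite ltrDl => /(_ ltr01); exists (v + 1).
have [||c] := @IVT R f b v y bv.
- apply: derivable_within_continuous => z; rewrite in_itv /= => /andP[bz _].
  by case: (f_derive (D_up Db bz)).
- by rewrite ge_min le_max fby yv orbT.
- by rewrite in_itv /= => /andP[bc _] fc; exists c => //; exact: D_up bc.
Unshelve. all: by end_near. Qed.

Lemma derive_gt0_inv_ge b y : D b -> f b <= y -> b <= finv y.
Proof.
move=> Db fby; have [Dy fy] := derive_gt0_invK (derive_gt0_image Db fby).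
by rewrite -derive_gt0_leE // fy.
Qed.

Lemma derive_gt0_inv_le y z : (f @` D) y -> y <= z -> finv y <= finv z.
Proof.
move=> fDy yz; have [Dy fy] := derive_gt0_invK fDy.
by apply: derive_gt0_inv_ge; rewrite ?fy.
Qed.

Lemma cvg_derive_gt0_inv b : D b -> finv y @[y --> +oo] --> +oo.
Proof.
move=> Db; apply/cvgryPge => A; near=> y.
apply: le_trans (_ : Num.max b A <= _); first by rewrite le_max lexx orbT.
apply: derive_gt0_inv_ge; first by apply: D_up Db _; rewrite le_max lexx.
by near: y; exact: nbhs_pinfty_ge (num_real _).
Unshelve. all: by end_near. Qed.

Lemma measurable_derive_gt0_inv b : D b -> measurable_fun `[f b, +oo[ finv.
Proof.
move=> Db.
(* extend the restriction by a constant to a globally monotone function *)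
apply: (eq_measurable_fun (fun y => finv (Num.max (f b) y))).
  move=> y; rewrite inE /= in_itv /= andbT => by_.
  by congr finv; apply/max_idPr.
apply: measurable_realfun.nondecreasing_measurable => // y z yz.
apply: derive_gt0_inv_le.
  by apply: (derive_gt0_image Db); rewrite le_max lexx.
by rewrite ge_max !le_max lexx yz orbT.
Qed.

Lemma measurable_derive_gt0 b : D b -> measurable_fun `[b, +oo[ f.
Proof.
move=> Db; apply: measurable_realfun.subspace_continuous_measurable_fun => //.
apply: derivable_within_continuous => x; rewrite in_itv /= andbT => bx.
by case: (f_derive (D_up Db bx)).
Qed.

End InverseAtInfinity.

(** * Indices of regular variation *)

Lemma cvg_powR_pinfty (R : realType) (p : R) : 0 < p ->
  x `^ p @[x --> +oo] --> +oo.
Proof.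
move=> p0; apply/cvgryPge => A; near=> x.
have x1 : Num.max 0 A `^ p^-1 <= x by near: x; exact: nbhs_pinfty_ge (num_real _).
have A0 : 0 <= Num.max 0 A by rewrite le_max lexx.
apply: le_trans (_ : Num.max 0 A <= _); first by rewrite le_max lexx orbT.
rewrite -[leLHS](powRr1 A0) -(mulVf (lt0r_neq0 p0)) powRrM.
by apply: ge0_ler_powR; rewrite ?nnegrE ?powR_ge0 ?(ltW p0) // (le_trans _ x1) ?powR_ge0.
Unshelve. all: by end_near. Qed.

Lemma cvg_powRN_pinfty (R : realType) (p : R) : 0 < p ->
  x `^ (- p) @[x --> +oo] --> (0 : R).
Proof.
move=> p0; under eq_fun do rewrite powRN.
apply/gtr0_cvgV0; last exact: cvg_powR_pinfty.
by near=> x; apply: powR_gt0; near: x; exact: nbhs_pinfty_gt (num_real _).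
Unshelve. all: by end_near. Qed.

(** A nondecreasing function of index [a] at infinity dominates every power of
exponent less than [a]. *)
Lemma ratio_index_growth (R : realType) (f : R -> R) (a : \bar R) (r : R) :
  ratio_index +oo f a -> (r%:E < a)%E -> (\forall x \near +oo, 0 < f x) ->
  (\forall x \near +oo, forall y, x <= y -> f x <= f y) ->
  exists2 c, 0 < c & \forall x \near +oo, c * x `^ r <= f x.
Proof.
move=> fa ra f0 fmono; apply: power_growth; last first.
  near=> x; exists (f x); first by near: x.
  move=> y /andP[xy _]; have : forall y, x <= y -> f x <= f y by near: x.
  exact.
have ln2 : 0 < ln 2 :> R by rewrite ln_gt0 // ltr1n.
have r2 : ((2 `^ r)%:E < epowR 2 a)%E.
  case: a ra {fa} => [s| |//] /=.
    by rewrite !lte_fin => rs; rewrite /powR gt_eqF // ltr_expR ltr_pM2r.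
  by move=> _; have := ltr1n R 2; case: (ltgtP (2 : R) 1) => // _ _; exact: ltry.
have [_ /(_ _ r2) lo] := (cvg_EFin_ltP _ _ _).1 (fa 2 (ltr0n _ 2)).
near=> x; rewrite -ler_pdivlMr; last by near: x.
by apply: ltW; near: x.
Unshelve. all: by end_near. Qed.

Section Profile.
Context (R : realType) (kappa : R) (Phi : R -> R -> R) (rho : R).
Context (phiP : increasing_bijection (phi_of kappa Phi)).
Context (Phi_RV0 : in_RV0 (Phi^~ kappa) rho).
Context (phi_ge : \forall t \near 0^'+, t <= phi_of kappa Phi t).
Local Notation phi := (phi_of kappa Phi).
Local Notation g := (gen_inv phi).

Lemma cvg_sqrt_at_right : Num.sqrt t @[t --> (0 : R)^'+] --> (0 : R)^'+.
Proof.
move=> A [e /= e0 eA]; suff : \forall t \near 0^'+, A (Num.sqrt t) by [].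
near=> t; have t0 : 0 < t by [].
apply: eA; last by rewrite sqrtr_gt0.
rewrite /ball_ /= sub0r normrN ger0_norm ?sqrtr_ge0 //.
rewrite -(gtr0_norm e0) -sqrtr_sqr ltr_sqrt ?exprn_gt0 //.
by near: t; apply: nbhs_right_lt; rewrite exprn_gt0.
Unshelve. all: by end_near. Qed.

Lemma ratio_index_phi : ratio_index 0^'+ phi rho%:E.
Proof.
move=> l l0; have [a [_ _ _ /(_ (Num.sqrt l))]] := Phi_RV0.
rewrite sqrtr_gt0 => /(_ l0) lim.
pose q t := Phi (Num.sqrt l * Num.sqrt t) kappa / Phi (Num.sqrt t) kappa.
have limq : q t @[t --> 0^'+] --> Num.sqrt l `^ rho.
  exact: cvg_comp cvg_sqrt_at_right lim.
apply/fine_cvgP; split; first exact: nearW.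
have -> : l `^ rho = Num.sqrt l `^ rho * Num.sqrt l `^ rho.
  by rewrite -powRM ?sqrtr_ge0 // -expr2 sqr_sqrtr // ltW.
rewrite (_ : fine \o _ = q \* q); first exact: cvgM.
apply/funext => t.
by rewrite /= /phi_of sqrtrM ?ltW // -expr_div_n expr2.
Qed.

(** A negative index would make phi(2 x) < phi(x) for small x. *)
Lemma index_ge0 : 0 <= rho.
Proof.
rewrite leNgt; apply/negP => rho0.
have r2 : (epowR 2 rho%:E < 1%:E)%E.
  rewrite lte_fin /powR gt_eqF // expR_lt1 nmulr_rlt0 //.
  by rewrite ln_gt0 // ltr1n.
have [/(_ _ r2) up _] := (cvg_EFin_ltP _ _ _).1 (ratio_index_phi (ltr0n _ 2)).
have [x [x0]] : exists x, 0 < x /\ phi (2 * x) / phi x < 1.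
  by near (0 : R)^'+ => x; exists x; split => //; near: x.
rewrite ltr_pdivrMr ?mul1r ?incr_bij_gt0 //.
rewrite incr_bij_ltE ?mulr_ge0 ?(ltW x0) // ltNge.
by rewrite ler_pMl // ler1n.
Unshelve. all: by end_near. Qed.

(** If rho > 1, then 1 / phi(1/x), which has index rho at infinity, outgrows x^r
for some r > 1, although it is at most x because t <= phi(t) near 0. *)
Lemma index_le1 : rho <= 1.
Proof.
rewrite leNgt; apply/negP => rho1.
pose f t := (phi t^-1)^-1.
have fmono : \forall x \near +oo, forall y, x <= y -> f x <= f y.
  near=> x; have x0 : 0 < x by near: x; exact: nbhs_pinfty_gt (num_real _).
  move=> y xy; have y0 : 0 < y by exact: lt_le_trans xy.
  have phix : 0 < phi x^-1 by rewrite incr_bij_gt0 // invr_gt0.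
  have phiy : 0 < phi y^-1 by rewrite incr_bij_gt0 // invr_gt0.
  rewrite /f lef_pV2 // leNgt incr_bij_ltE ?invr_ge0 ?(ltW x0) ?(ltW y0) //.
  by rewrite -leNgt lef_pV2.
have f0 : \forall x \near +oo, 0 < f x.
  near=> t; rewrite /f invr_gt0 incr_bij_gt0 // invr_gt0.
  by near: t; exact: nbhs_pinfty_gt (num_real _).
pose r := (1 + rho) / 2.
have [r1 rr] : 1 < r /\ r < rho by rewrite !midf_lt.
have [c c0 cf] := ratio_index_growth (ratio_index_invV ratio_index_phi) rr f0 fmono.
have fle : \forall x \near +oo, f x <= x.
  have H : \forall t \near +oo, (1 * t)^-1 <= phi (1 * t)^-1 :=
    cvg_invM_at_right ltr01 phi_ge.
  near=> x; have x0 : 0 < x by near: x; exact: nbhs_pinfty_gt (num_real _).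
  have phix : 0 < phi x^-1 by rewrite incr_bij_gt0 // invr_gt0.
  by rewrite /f invf_ple // -[x]mul1r; near: x.
have r10 : 0 < r - 1 by rewrite subr_gt0.
have [x [x0 x1 x2 x3]] : exists x, [/\ 0 < x, c * x `^ r <= f x, f x <= x
    & c^-1 < x `^ (r - 1)].
  near +oo_R => x; exists x; split; near: x => //.
    exact: nbhs_pinfty_gt (num_real _).
  exact: (cvgryPgt _).1 (cvg_powR_pinfty r10) _.
move: x3; rewrite -[_^-1]mulr1 ltr_pdivrMl // ltNge => /negP; apply.
have xr : x `^ (r - 1) * x = x `^ r.
  rewrite -[in RHS](subrK 1 r) [RHS]powRD; last by rewrite (gt_eqF x0) implybT.
  by rewrite powRr1 // ltW.
by rewrite -(ler_pM2r x0) mul1r -mulrA xr (le_trans x1).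
Unshelve. all: by end_near. Qed.

Lemma ratio_index_gen_inv : ratio_index 0^'+ g (rho%:E)^-1.
Proof.
apply: (@ratio_index_inverse R 0^'+ 0^'+ _ _ [set t : R | 0 < t] phi) => //.
- by move=> x y x0 y0; rewrite incr_bij_ltE ?ltW.
- by move=> _ [u u0 <-]; rewrite /= gen_invK ?ltW.
- exact: cvg_gen_inv0.
- move=> l l0; near=> s; have s0 : 0 < s by [].
  have [|u u0 us] := @incr_bij_preimage _ _ phiP 1 (l * s) ler01; last by exists u.
  rewrite mulr_gt0 //= -ler_pdivlMl //; near: s; apply: nbhs_right_ltW.
  by rewrite mulr_gt0 ?invr_gt0 ?incr_bij_gt0.
- by move=> l l0; near=> s; rewrite /= mulr_gt0.
- by near=> s; exact: incr_bij_gt0.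
- by rewrite lee_fin index_ge0.
- exact: ratio_index_phi.
Unshelve. all: by end_near. Qed.

Context (d0 : R) (d0_dom : spade_dom kappa Phi d0).
Local Notation Psi := (Psi_of kappa Phi d0).
Local Notation Psinv := (Psi_inv kappa Phi d0).
Local Notation h := (fun t => t ^- 2 / g t^-1).

Lemma Psi_cvgy : Psi t @[t --> +oo] --> +oo.
Proof.
apply: cvg_Psi => //.
have ge : \forall s \near 0^'+, g s <= phi (g s) := cvg_gen_inv0 phiP phi_ge.
apply: filterS2 ge (near0_preimage phiP ltr01) => s gs [u /andP[u0 _] us].
move: gs; rewrite -us.
by rewrite (gen_invK phiP (ltW u0)).
Qed.

Lemma Psi_deriv t : Psi_dom kappa Phi t -> is_derive t 1 Psi (h t).
Proof. exact: is_derive_Psi. Qed.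

Lemma Psi_deriv_gt0 t : Psi_dom kappa Phi t -> 0 < h t.
Proof.
move=> Dt; rewrite divr_gt0 //; last exact: spade_dom_gen_inv_gt0.
by rewrite invr_gt0 exprn_gt0 // (Psi_dom_gt0 Dt).
Qed.

Lemma near_Psi_dom : \forall t \near +oo, Psi_dom kappa Phi t.
Proof.
near=> t; apply: (@Psi_dom_up _ _ _ phiP d0^-1).
  by rewrite /Psi_dom /= invrK.
by near: t; exact: nbhs_pinfty_ge (num_real _).
Unshelve. all: by end_near. Qed.

Lemma ratio_index_Psi : ratio_index +oo Psi ((rho%:E)^-1 - 1).
Proof.
apply: (@ratio_index_primitive _ _ g).
- apply: filterS (near0_preimage phiP ltr01) => s [u /andP[u0 _] <-].
  by rewrite (gen_invK phiP (ltW u0)).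
- by apply: filterS near_Psi_dom => t; exact: Psi_deriv.
- exact: Psi_cvgy.
- exact: ratio_index_gen_inv.
Qed.

Lemma Psi_start : exists2 b, Psi_dom kappa Phi b & 0 < Psi b.
Proof.
near +oo_R => b; exists b; near: b; first exact: near_Psi_dom.
exact: (cvgryPgt _).1 Psi_cvgy _.
Unshelve. all: by end_near. Qed.

Lemma ratio_index_Psi_inv : ratio_index +oo Psinv ((rho%:E)^-1 - 1)^-1.
Proof.
have [b Db Psib] := Psi_start.
apply: (@ratio_index_inverse _ +oo +oo _ _ (Psi_dom kappa Phi) Psi).
- exact: (derive_gt0_lt (Psi_dom_up phiP) Psi_deriv Psi_deriv_gt0).
- exact: (derive_gt0_invK (Psi_dom_up phiP) Psi_deriv Psi_deriv_gt0).
- exact: (cvg_derive_gt0_inv (Psi_dom_up phiP) Psi_deriv Psi_deriv_gt0 Psi_cvgy Db).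
- move=> l l0; near=> y.
  apply: (derive_gt0_image (Psi_dom_up phiP) Psi_deriv Psi_cvgy Db).
  by rewrite -ler_pdivrMl //; near: y; exact: nbhs_pinfty_ge (num_real _).
- move=> l l0; near=> y; apply: (Psi_dom_up phiP Db).
  by rewrite -ler_pdivrMl //; near: y; exact: nbhs_pinfty_ge (num_real _).
- exact: Psi_dom_gt0.
- exact: (cvgryPgt _).1 Psi_cvgy _.
- have := index_ge0; have := index_le1; rewrite le_eqVlt => /predU1P[->|r1].
    by rewrite inve1 subee.
  rewrite le_eqVlt => /predU1P[<-|r0]; first by rewrite inve0 addye // leey.
  by rewrite inver gt_eqF // -EFinB lee_fin subr_ge0 invf_ge1 // ltW.
- exact: ratio_index_Psi.
Unshelve. all: by end_near. Qed.

(** As Psi(t) = - spade(1/t), the inverses are related by inversion of the value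
and change of sign of the argument. *)
Lemma spade_inv_oppE b s : Psi_dom kappa Phi b -> Psi b <= s ->
  spade_range kappa Phi d0 (- s) /\ spade_inv kappa Phi d0 (- s) = (Psinv s)^-1.
Proof.
move=> Db bs.
have im := derive_gt0_image (Psi_dom_up phiP) Psi_deriv Psi_cvgy Db bs.
have [Dx xs] := derive_gt0_invK (Psi_dom_up phiP) Psi_deriv Psi_deriv_gt0 im.
have E : spade kappa Phi d0 (Psinv s)^-1 = - s by apply: oppr_inj; rewrite opprK; exact: xs.
split; first by exists (Psinv s)^-1.
rewrite /spade_inv -E; apply: pinvKV; last by rewrite inE.
move=> x y; rewrite !inE => Sx Sy xy; apply: invr_inj.
apply: (derive_gt0_inj (Psi_dom_up phiP) Psi_deriv Psi_deriv_gt0); rewrite ?inE.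
- by rewrite /Psi_dom /= invrK.
- by rewrite /Psi_dom /= invrK.
- by rewrite /Psi_of !invrK xy.
Qed.

End Profile.

(** * Consequences for the inverse of the primitive *)

(** The clauses common to [in_RV] and [in_RV_infty], independent of the index. *)
Definition positive_measurable_tail (R : realType) (D : set R) (f : R -> R) :=
  exists a : R, [/\ 0 < a, `[a, +oo[ `<=` D, measurable_fun `[a, +oo[ f
    & {in `[a, +oo[, forall x, 0 < f x}].

Lemma in_RV_ratio_index (R : realType) (D : set R) (f : R -> R) (r : R) :
  positive_measurable_tail D f -> ratio_index +oo f r%:E -> in_RV D f r.
Proof.
move=> [a [a0 aD mf f0]] fr; exists a; split => // l l0.
by have /fine_cvgP[] := fr l l0.
Qed.

Lemma in_RV_infty_ratio_index (R : realType) (D : set R) (f : R -> R) :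
  positive_measurable_tail D f -> ratio_index +oo f +oo%E -> in_RV_infty D f.
Proof.
move=> [a [a0 aD mf f0]] foo; exists a; split => //; split.
- move=> l /andP[l0 l1]; have := foo l l0.
  by rewrite /= l1 => /fine_cvgP[].
- have := foo 1 ltr01.
  by rewrite /= ltxx eqxx => /fine_cvgP[].
- move=> l l1; have l0 : 0 < l by exact: lt_trans l1.
  have := foo l l0; rewrite /= ltNge (ltW l1) (gt_eqF l1) /=.
  by move=> /cvgeryP.
Qed.

Section Conclusions.
Context (R : realType) (kappa : R) (Phi : R -> R -> R) (rho : R).
Context (phiP : increasing_bijection (phi_of kappa Phi)).
Context (Phi_RV0 : in_RV0 (Phi^~ kappa) rho).
Context (phi_ge : \forall t \near 0^'+, t <= phi_of kappa Phi t).
Context (d0 : R) (d0_dom : spade_dom kappa Phi d0).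
Local Notation Psi := (Psi_of kappa Phi d0).
Local Notation Psinv := (Psi_inv kappa Phi d0).
Local Notation Psi_up := (Psi_dom_up phiP).
Local Notation dPsi := (Psi_deriv phiP d0_dom).
Local Notation dPsi_gt0 := (Psi_deriv_gt0 phiP).
Local Notation Psi_oo := (Psi_cvgy phiP phi_ge d0_dom).

Lemma Psi_tail : positive_measurable_tail (Psi_dom kappa Phi) Psi.
Proof.
have [b Db Psib] := Psi_start phiP phi_ge d0_dom.
exists b; split.
- exact: Psi_dom_gt0 Db.
- by move=> x; rewrite /= in_itv /= andbT; exact: Psi_up.
- exact: (measurable_derive_gt0 Psi_up dPsi Db).
- move=> x; rewrite in_itv /= andbT => bx; apply: lt_le_trans Psib _.
  by rewrite (derive_gt0_leE Psi_up dPsi dPsi_gt0 Db) //; exact: Psi_up bx.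
Qed.

Lemma Psi_inv_tail : positive_measurable_tail (Psi_range kappa Phi d0) Psinv.
Proof.
have [b Db Psib] := Psi_start phiP phi_ge d0_dom.
exists (Psi b); split => //.
- move=> y; rewrite /= in_itv /= andbT => by_.
  exact: (derive_gt0_image Psi_up dPsi Psi_oo Db).
- exact: (measurable_derive_gt0_inv Psi_up dPsi dPsi_gt0 Psi_oo Db).
- move=> y; rewrite in_itv /= andbT => by_.
  apply: lt_le_trans (Psi_dom_gt0 Db) _.
  exact: (derive_gt0_inv_ge Psi_up dPsi dPsi_gt0 Psi_oo Db).
Qed.

Local Notation Psi_inv_facts s := [/\ 0 < Psinv s,
    forall y, s <= y -> Psinv s <= Psinv y,
    spade_range kappa Phi d0 (- s)
  & spade_inv kappa Phi d0 (- s) = (Psinv s)^-1].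

Lemma near_Psi_inv : \forall s \near +oo, Psi_inv_facts s.
Proof.
have [b Db Psib] := Psi_start phiP phi_ge d0_dom.
near=> s; have bs : Psi b <= s by near: s; exact: nbhs_pinfty_ge (num_real _).
have [sr si] := spade_inv_oppE phiP phi_ge d0_dom Db bs.
have im := derive_gt0_image Psi_up dPsi Psi_oo Db bs.
split=> //; last first.
  by move=> y sy; exact: (derive_gt0_inv_le Psi_up dPsi dPsi_gt0 Psi_oo im sy).
apply: lt_le_trans (Psi_dom_gt0 Db) _.
exact: (derive_gt0_inv_ge Psi_up dPsi dPsi_gt0 Psi_oo Db bs).
Unshelve. all: by end_near. Qed.

(** The inverse of Psi dominates s^gamma for gamma below its index, and
(Phi^spade)^-1(-s) is its reciprocal. *)
Lemma sqrt_spade_inv_le (gamma : R) :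
  (gamma%:E < ((rho%:E)^-1 - 1)^-1)%E ->
  exists A, \forall s \near +oo,
    Num.sqrt (spade_inv kappa Phi d0 (- s)) <= A * s `^ (- (gamma / 2)).
Proof.
move=> gtau.
have [||c c0 cP] := ratio_index_growth
    (ratio_index_Psi_inv phiP Phi_RV0 phi_ge d0_dom) gtau.
- by apply: filterS near_Psi_inv => s [].
- by apply: filterS near_Psi_inv => s [].
exists (Num.sqrt c^-1); near=> s.
have s0 : 0 < s by near: s; exact: nbhs_pinfty_gt (num_real _).
have [P0 _ _ ->] : Psi_inv_facts s by near: s; exact: near_Psi_inv.
have -> : s `^ (- (gamma / 2)) = Num.sqrt (s `^ (- gamma)).
  by rewrite -powR12_sqrt ?powR_ge0 // -powRrM mulNr.
rewrite -sqrtrM ?invr_ge0 ?(ltW c0) // ler_sqrt; last first.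
  by rewrite mulr_ge0 ?invr_ge0 ?powR_ge0 ?(ltW c0).
rewrite powRN -invfM lef_pV2 ?posrE ?mulr_gt0 ?powR_gt0 //.
by near: s.
Unshelve. all: by end_near. Qed.

(** When rho = 0 the inverse of Psi has index 0, so its reciprocal f satisfies
f(2 s) / f(s) --> 1 > 2^(-r), and the comparison with powers applies to f with
a negative exponent. *)
Lemma spade_inv_ge (r : R) : rho = 0 -> 0 < r ->
  exists2 c, 0 < c & \forall s \near +oo, c * s `^ (- r) <= spade_inv kappa Phi d0 (- s).
Proof.
move=> rho0 r0.
have [||c c0 cP] := @power_growth R (fun s => (Psinv s)^-1) (- r) _ _.
- have r2 : (epowR 2 ((rho%:E)^-1 - 1)^-1 < (2 `^ r)%:E)%E.
    rewrite rho0 inve0 addye // lte_fin powRr0 /powR gt_eqF //.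
    by rewrite expR_gt1 mulr_gt0 // ln_gt0 // ltr1n.
  have [/(_ _ r2) up _] :=
    (cvg_EFin_ltP _ _ _).1 (ratio_index_Psi_inv phiP Phi_RV0 phi_ge d0_dom (ltr0n _ 2)).
  near=> s; have s0 : 0 < s by near: s; exact: nbhs_pinfty_gt (num_real _).
  have [P0 Pmono _ _] : Psi_inv_facts s by near: s; exact: near_Psi_inv.
  have P2 : 0 < Psinv (2 * s).
    by apply: lt_le_trans P0 (Pmono _ _); rewrite ler_peMl ?(ltW s0) // ler1n.
  rewrite powRN -invfM lef_pV2 ?posrE // ?mulr_gt0 ?powR_gt0 //.
  by rewrite -ler_pdivrMr //; apply: ltW; near: s.
- have [X [_ hX]] := near_Psi_inv.
  near=> x; have Xx : X < x by near: x; exact: nbhs_pinfty_gt (num_real _).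
  have x0 : 0 < x by near: x; exact: nbhs_pinfty_gt (num_real _).
  have x2 : x <= 2 * x by rewrite ler_peMl ?(ltW x0) // ler1n.
  have [P2 _ _ _] := hX _ (lt_le_trans Xx x2).
  exists (Psinv (2 * x))^-1; first by rewrite invr_gt0.
  move=> y /andP[xy yx]; have [Py0 Pmono _ _] := hX _ (lt_le_trans Xx xy).
  by rewrite lef_pV2 // Pmono.
- exists c => //; near=> s.
  have [P0 _ _ ->] : Psi_inv_facts s by near: s; exact: near_Psi_inv.
  by near: s.
Unshelve. all: by end_near. Qed.

End Conclusions.

Theorem theorem5p7 (R : realType) (E : normedModType R)
    (dot : {dot E for (@idfun R)})
    (dot_norm : forall x : E, `|x| ^+ 2 = dot x x)
    (E_findim : finite_dimensional E)
    (m : nat) (Cs : 'I_m -> set E)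
    (Cs_closed : forall i, closed (Cs i))
    (Cs_convex : forall i, convex_set (Cs i))
    (C_neq0 : \bigcap_i Cs i !=set0)
    (Phi : R -> R -> R)
    (Phi_strict : strict_consistent_error_bound Cs Phi)
    (C_neqT : \bigcap_i Cs i <> [set: E])
    (kappa : R) (x0 : E)
    (x0_notin_C : ~ (\bigcap_i Cs i) x0)
    (kappa_ge : Num.max (set_dist 0 (\bigcap_i Cs i)) `|x0| <= kappa)
    (Phi_cont : {within `[0, +oo[, continuous (Phi^~ kappa)})
    (rho : R)
    (Phi_RV0 : in_RV0 (Phi^~ kappa) rho)
    (d0 : R) (d0_dom : spade_dom kappa Phi d0) :
  [/\ 0 <= rho <= 1,

      0 < rho < 1 ->
      [/\ in_RV (Psi_dom kappa Phi) (Psi_of kappa Phi d0) (rho^-1 - 1),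
          in_RV (Psi_range kappa Phi d0) (Psi_inv kappa Phi d0)
            (rho / (1 - rho))
        & forall delta : R, 0 < delta ->
            let gamma := rho / (1 - rho) - delta in
            0 < gamma ->
            exists M A : R, 0 < M /\
              forall s : R, M <= s ->
                spade_range kappa Phi d0 (- s) /\
                Num.sqrt (spade_inv kappa Phi d0 (- s))
                  <= A * s^-1 `^ (gamma / 2)],

      rho = 1 ->
      [/\ in_RV (Psi_dom kappa Phi) (Psi_of kappa Phi d0) 0,
          in_RV_infty (Psi_range kappa Phi d0) (Psi_inv kappa Phi d0)
        & forall r : R, 0 < r ->
            little_o_pinfty [set s | spade_range kappa Phi d0 (- s)]
              (fun s => Num.sqrt (spade_inv kappa Phi d0 (- s)))
              (fun s => s `^ (- r))]

    & rho = 0 ->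
      [/\ in_RV_infty (Psi_dom kappa Phi) (Psi_of kappa Phi d0),
          in_RV (Psi_range kappa Phi d0) (Psi_inv kappa Phi d0) 0
        & forall r : R, 0 < r ->
            little_o_pinfty [set s | spade_range kappa Phi d0 (- s)]
              (fun s => s `^ (- r))
              (fun s => spade_inv kappa Phi d0 (- s))]].

Proof.
move: Phi_strict => [bound strict].
have [Phi_ge0 _ mono1 _] := bound.
(* kappa = 0 would put both x0 and a point of C at the origin. *)
have k0 : 0 < kappa.
  rewrite lt_neqAle; apply/andP; split; last first.
    by apply: le_trans kappa_ge; rewrite le_max normr_ge0 orbT.
  apply/eqP => kE; apply: x0_notin_C.
  move: kappa_ge; rewrite -kE ge_max normr_le0 => /andP[dist0 /eqP ->].
  apply: contrapT => C0.
  have Ccl : closed (\bigcap_i Cs i).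
    by apply: closed_bigI => i _; exact: Cs_closed.
  by have := set_dist_gt0 C_neq0 Ccl C0; rewrite ltNge dist0.
have [_ _ Phi0] := mono1 _ (ltW k0).
have phiP : increasing_bijection (phi_of kappa Phi).
  apply: increasing_phi_of => //; last exact: strict.
  by move=> a a0; apply: Phi_ge0 => //; exact: ltW.
have phi_ge : \forall t \near 0^'+, t <= phi_of kappa Phi t.
  have [t0 t00 Phit] := error_bound_ge_id dot_norm Cs_closed C_neq0 bound x0_notin_C kappa_ge.
  near=> t; have tp : 0 < t by [].
  have tt : Num.sqrt t <= t0.
    rewrite -(gtr0_norm t00) -sqrtr_sqr ler_sqrt ?exprn_ge0 ?(ltW t00) //.
    by near: t; apply: nbhs_right_ltW; rewrite exprn_gt0.
  have P0 : 0 <= Phi (Num.sqrt t) kappa by apply: Phi_ge0; rewrite ?sqrtr_ge0 // ltW.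
  rewrite -[leLHS]sqr_sqrtr ?(ltW tp) // /phi_of ler_pXn2r ?nnegrE ?sqrtr_ge0 //.
  by apply: Phit; rewrite sqrtr_gt0 tp.
have rho0 := index_ge0 phiP Phi_RV0.
have rho1 := index_le1 phiP Phi_RV0 phi_ge.
have iPsi := ratio_index_Psi phiP Phi_RV0 phi_ge d0_dom.
have iPsinv := ratio_index_Psi_inv phiP Phi_RV0 phi_ge d0_dom.
have tPsi := Psi_tail phiP phi_ge d0_dom.
have tPsinv := Psi_inv_tail phiP phi_ge d0_dom.
have near_inv := near_Psi_inv phiP phi_ge d0_dom.
have near_range : \forall s \near +oo, spade_range kappa Phi d0 (- s).
  by apply: filterS near_inv => s [].
split.
- by rewrite rho0 rho1.
- move=> /andP[r0 r1].
  have e1 : ((rho%:E)^-1 - 1)%E = (rho^-1 - 1)%:E by rewrite inver gt_eqF.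
  have r10 : 0 < rho^-1 - 1 by rewrite subr_gt0 invf_gt1.
  have e2 : (((rho%:E)^-1 - 1)^-1)%E = (rho / (1 - rho))%:E.
    rewrite e1 inver gt_eqF //; congr EFin; field.
    by rewrite subr_eq0 (gt_eqF r1) (gt_eqF r0).
  split.
  + by apply: in_RV_ratio_index => //; move: iPsi; rewrite e1.
  + by apply: in_RV_ratio_index => //; move: iPsinv; rewrite e2.
  + move=> delta delta0 gamma gamma0.
    have [A hA] : exists A, \forall s \near +oo,
        Num.sqrt (spade_inv kappa Phi d0 (- s)) <= A * s `^ (- (gamma / 2)).
      apply: (sqrt_spade_inv_le phiP Phi_RV0 phi_ge d0_dom).
      by rewrite e2 lte_fin /gamma ltrBlDr ltrDl.
    have [X [_ hX]] : \forall s \near +oo, [/\ 0 < s,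
        spade_range kappa Phi d0 (- s) &
        Num.sqrt (spade_inv kappa Phi d0 (- s)) <= A * s `^ (- (gamma / 2))].
      by near=> s; split; near: s => //; exact: nbhs_pinfty_gt (num_real _).
    exists (X + 1), A; split; first by have [] := hX (X + 1); rewrite ?ltrDl.
    move=> s Ms; have [|s0 sr sle] := hX s; first by apply: lt_le_trans Ms; rewrite ltrDl.
    split=> //; apply: le_trans sle _.
    by rewrite -[s^-1]powR_inv1 ?(ltW s0) // -powRrM mulN1r.
- move=> rE.
  have e1 : ((rho%:E)^-1 - 1 = 0)%E by rewrite rE inve1 subee.
  have e2 : (((rho%:E)^-1 - 1)^-1 = +oo)%E by rewrite e1 inve0.
  split.
  + by apply: in_RV_ratio_index => //; move: iPsi; rewrite e1.
  + by apply: in_RV_infty_ratio_index => //; move: iPsinv; rewrite e2.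
  + move=> r r_gt0; split => //.
    have [A hA] : exists A, \forall s \near +oo,
        Num.sqrt (spade_inv kappa Phi d0 (- s)) <= A * s `^ (- ((2 * r + 2) / 2)).
      (* the exponent - (r + 1) leaves a factor 1/s after division by s^(-r) *)
      by apply: (sqrt_spade_inv_le phiP Phi_RV0 phi_ge d0_dom); rewrite e2 ltry.
    have lim : A * s `^ (- 1) @[s --> +oo] --> (0 : R).
      rewrite -[X in _ --> X](mulr0 A); apply: cvgM; first exact: cvg_cst.
      exact: cvg_powRN_pinfty.
    apply: (@squeeze_cvgr _ _ _ R (fun=> 0) (fun s => A * s `^ (- 1)) _ _ _ (cvg_cst _) lim).
    near=> s.
    have s0 : 0 < s by near: s; exact: nbhs_pinfty_gt (num_real _).
    rewrite divr_ge0 ?sqrtr_ge0 ?powR_ge0 //= ler_pdivrMr ?powR_gt0 //.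
    rewrite -mulrA -powRD; last by rewrite (gt_eqF s0) implybT.
    rewrite (_ : - 1 + - r = - ((2 * r + 2) / 2)); last by field.
    by near: s.
- move=> rE.
  have e1 : ((rho%:E)^-1 - 1 = +oo)%E by rewrite rE inve0 addye.
  have e2 : (((rho%:E)^-1 - 1)^-1 = 0)%E by rewrite e1.
  split.
  + by apply: in_RV_infty_ratio_index => //; move: iPsi; rewrite e1.
  + by apply: in_RV_ratio_index => //; move: iPsinv; rewrite e2.
  + move=> r r_gt0; split => //.
    have r20 : 0 < r / 2 by rewrite divr_gt0.
    have [c c0 hc] := spade_inv_ge phiP Phi_RV0 phi_ge d0_dom rE r20.
    have lim : c^-1 * s `^ (- (r / 2)) @[s --> +oo] --> (0 : R).
      rewrite -[X in _ --> X](mulr0 c^-1); apply: cvgM; first exact: cvg_cst.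
      exact: cvg_powRN_pinfty.
    apply: (@squeeze_cvgr _ _ _ R (fun=> 0) (fun s => c^-1 * s `^ (- (r / 2))) _ _ _ (cvg_cst _) lim).
    near=> s.
    have s0 : 0 < s by near: s; exact: nbhs_pinfty_gt (num_real _).
    have cU : c * s `^ (- (r / 2)) <= spade_inv kappa Phi d0 (- s) by near: s.
    have U0 : 0 < spade_inv kappa Phi d0 (- s).
      by apply: lt_le_trans cU; rewrite mulr_gt0 ?powR_gt0.
    rewrite divr_ge0 ?powR_ge0 ?(ltW U0) //= ler_pdivrMr //.
    rewrite -mulrA mulrC ler_pdivlMr // mulrC.
    apply: le_trans (ler_wpM2l (powR_ge0 s (- (r / 2))) cU).
    rewrite mulrCA -powRD; last by rewrite (gt_eqF s0) implybT.
    by rewrite (_ : - (r / 2) + - (r / 2) = - r) //; field.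
Unshelve. all: by end_near. Qed.
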